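(* Given $\delta$ with $0<\delta<1$, there exists a sequence $\{e_j\}_{j\in\mathbb N}$ in a Hilbert space $H$ satisfying the following properties. (1) $\{e_j\}_{j\in\mathbb N}$ is a summation basis of $H$ (relative to a triangular matrix). (2) $\{e_j\}_{j\in\mathbb N}$ is block orthogonal: there exists an increasing sequence of integers $n_s$ such that $H_{[n_s,n_{s+1})}\perp H_{[n_t,n_{t+1})}$ for every $s\ne t$, where $H_{[n_s,n_{s+1})}=\operatorname{span}\{e_j: n_s\le j<n_{s+1}\}$. (3) There exists a bounded operator $A:H\to H$ satisfying $\|A\|\le1$, $Ae_j=\lambda_j(A)e_j$ with scalars $\lambda_j(A)$, $\delta\le|\lambda_j(A)|=\frac{\|Ae_j\|}{\|e_j\|}\le\|A\|\le1$ for all $j\in\mathbb N$, and such that for every finite partition $\bigcup_{s=1}^rI_s=\mathbb N$ there is a restriction $A|H_{I_s}$ ($1\le s\le r$) which is not left invertible. (4) Every bounded operator $T:H\to H$ satisfying $Te_j=\lambda_j(T)e_j$ with scalars $\lambda_j(T)$ ($j\in\mathbb N$) and $1\ge\|T\|\ge\inf_j|\lambda_j(T)|>\delta$ is invertible.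
   Context: Hilbert spaces are complex. For $I\subset\mathbb N$, $H_I=\operatorname{span}\{e_j:j\in I\}$, where $\operatorname{span}$ denotes the closed linear span. A restriction $A|H_I$ is left invertible if $\inf\{\|Ax\|: x\in H_I,\ \|x\|=1\}>0$. A summation basis of $H$ relative to a (triangular) matrix $V=\{v_{nj}\}_{n,j\in\mathbb N}$ of scalars, with $v_{nj}=0$ for $j>n$, is a sequence $\{e_j\}_{j\in\mathbb N}$ in $H$ such that for every $x\in H$ there exists a unique sequence of scalars $\{a_j\}_{j\in\mathbb N}$ satisfying $$x=\lim_{n\to\infty}\sum_{j=1}^nv_{nj}a_je_j\quad\text{(norm convergence)}.$$ *)

(* Defs.v *)
From HB Require Import structures.
From mathcomp Require Import all_boot all_order all_algebra.
From mathcomp Require Import all_classical all_reals all_analysis.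
From mathcomp Require Import complex.

Set Implicit Arguments.
Unset Strict Implicit.
Unset Printing Implicit Defensive.

Import Order.TTheory GRing.Theory Num.Theory.
Import numFieldNormedType.Exports.

Local Open Scope classical_set_scope.
Local Open Scope ring_scope.

(* The inner product is linear in its first argument and conjugate-linear in
   its second one. *)
Record hilbertSpace (R : realType) := HilbertSpace {
  hilbert_sort :> completeNormedModType R[i];
  inner : {dot hilbert_sort for Num.conj};
  inner_norm : forall x : hilbert_sort, inner x x = `|x| ^+ 2 }.

(* Norms over the field R[i] are R[i]-valued; they are nonnegative there, hence
   real, so that taking the real part loses nothing. *)
Definition rnorm (R : realType) (V : normedZmodType R[i]) (x : V) : R :=
  complex.Re `|x|.

Section Hilbert.
Context {R : realType} {H : hilbertSpace R}.
Implicit Types (e : nat -> H) (I : set nat) (T : {linear H -> H}).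

Definition closed_span e I : set H :=
  closure [set x : H | exists (n : nat) (a : nat -> R[i]),
    (forall j, ~ I j -> a j = 0) /\ x = \sum_(j < n) a j *: e j].

(* Indices start at 0: the n-th partial sum is over the indices j <= n, matching
   the support of the n-th row of the triangular matrix v. *)
Definition summation_basis e (v : nat -> nat -> R[i]) : Prop :=
  (forall n j, (n < j)%N -> v n j = 0) /\
  forall x : H, exists! a : nat -> R[i],
    (fun n : nat => \sum_(j < n.+1) (v n j * a j) *: e j) @ \oo --> x.

Definition orthogonal_sets (K L : set H) : Prop :=
  forall x y, K x -> L y -> inner H x y = 0.

(* The blocks [n s, n s.+1) are nonempty and exhaust the index set. *)
Definition block_orthogonal e : Prop :=
  exists n : nat -> nat,
    [/\ n 0%N = 0%N, (forall s, (n s < n s.+1)%N) &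
        forall s t, s != t ->
          orthogonal_sets (closed_span e [set j | (n s <= j < n s.+1)%N])
                          (closed_span e [set j | (n t <= j < n t.+1)%N])].

Definition bounded_operator T : Prop := bounded_near T (nbhs (0 : H)).

Definition opnorm T : \bar R :=
  ereal_sup [set (rnorm (T x))%:E | x in [set x : H | rnorm x <= 1]].

(* The infimum is taken in the extended reals, so that it is +oo, and the
   restriction is left invertible, when K = {0}. *)
Definition left_invertible_on T (K : set H) : Prop :=
  (0 < ereal_inf [set (rnorm (T x))%:E | x in
                   [set x : H | K x /\ rnorm x = 1%R]])%E.

Definition invertible_operator T : Prop :=
  exists S : {linear H -> H}, [/\ bounded_operator S, cancel T S & cancel S T].

End Hilbert.

(* Main.v *)
(* The space is an orthogonal sum of blocks, each being the polynomials modulo X^n - 1,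
   for some n that grows along the sequence of blocks, with a weighted l2 norm of the
   coefficients, of weights w_k = (1 + gam k) r^k. The eigenvectors are the idempotents at
   the n-th roots of unity, so that diagonal operators are the multiplications modulo
   X^n - 1, and A is delta times the multiplication by X, which has norm at most 1
   because w_(k+1) <= w_k / delta.

   Let f act as a contraction with |f| >= d > delta at the roots of unity. Applying it to
   1 gives sum w_k^2 |f_k|^2 <= 1, while sum |f_k|^2 >= d^2 by Parseval; since
   (1 + gam k)^2 >= 1 + (1 / delta^2 - 1) k up to a small error, the area sum k |f_k|^2 is
   less than delta^2. The area is the squared Hilbert-Schmidt norm of the part of the
   multiplication that wraps around, hence the lower triangular Toeplitz part is bounded
   below by d - delta, and it remains so in the weighted norm because X d/dX is a
   derivation. The wrapped part is small in the weighted norm, so f is invertible with a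
   bound that does not depend on n.

   On the other hand, A restricted to the polynomials vanishing outside a set J of roots
   of unity has lower bound at most r^(1 - |J|): reflecting the free zeros of such a
   polynomial in the circle of radius r divides its norm by at least r for each zero.
   With r^n tending to infinity, no finite partition of the indices helps. *)

Require Import Defs.
From HB Require Import structures.
From mathcomp Require Import all_boot all_order all_algebra.
From mathcomp Require Import all_classical all_reals all_analysis.
From mathcomp Require Import complex.
From mathcomp Require Import cyclic separable cyclotomic ring lra zify.

Set Implicit Arguments.
Unset Strict Implicit.
Unset Printing Implicit Defensive.

Import Order.TTheory GRing.Theory Num.Theory.
Import numFieldNormedType.Exports.

Local Open Scope classical_set_scope.
Local Open Scope ring_scope.

(** * Real-valued modulus of complex numbers and l2 norms of finite segments *)

Section Modulus.
Context {R : rcfType}.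
Local Notation C := R[i].
Implicit Types (z : C) (r : R) (x y : nat -> C).

Definition modc z : R := complex.Re `|z|.

Lemma modcE z : `|z| = (modc z)%:C%C.
Proof. by rewrite /modc normc_def. Qed.

Lemma modc_sqrt z : modc z = Num.sqrt (complex.Re z ^+ 2 + complex.Im z ^+ 2).
Proof. by rewrite /modc normc_def. Qed.

Lemma modc_sqr z : modc z ^+ 2 = complex.Re z ^+ 2 + complex.Im z ^+ 2.
Proof. by rewrite modc_sqrt sqr_sqrtr // addr_ge0 ?sqr_ge0. Qed.

Lemma modc_ge0 z : 0 <= modc z.
Proof. by rewrite modc_sqrt sqrtr_ge0. Qed.
Hint Resolve modc_ge0 : core.

Lemma modcM : {morph modc : z w / z * w}.
Proof. by move=> z w; apply: complexI; rewrite -modcE normrM !modcE rmorphM. Qed.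

Lemma modcD z w : modc (z + w) <= modc z + modc w.
Proof. by rewrite -lecR rmorphD /= -!modcE ler_normD. Qed.

Lemma modc0 : modc 0 = 0.
Proof. by apply: complexI; rewrite -modcE normr0. Qed.

Lemma modc1 : modc 1 = 1.
Proof. by apply: complexI; rewrite -modcE normr1. Qed.

Lemma modcN z : modc (- z) = modc z.
Proof. by rewrite /modc normrN. Qed.

Lemma modcX z n : modc (z ^+ n) = modc z ^+ n.
Proof. by elim: n => [|n IH]; rewrite ?modc1 // !exprS modcM IH. Qed.

Lemma modc_eq0 z : (modc z == 0) = (z == 0).
Proof. by rewrite -(normr_eq0 z) modcE -(inj_eq (@complexI R)). Qed.

Lemma modc_real r : modc r%:C%C = `|r|.
Proof. by rewrite modc_sqrt /= expr0n addr0 sqrtr_sqr. Qed.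

Lemma modc_pos r : 0 <= r -> modc r%:C%C = r.
Proof. by move=> r0; rewrite modc_real ger0_norm. Qed.

Lemma modc_nat n : modc n%:R = n%:R.
Proof. by rewrite -[n%:R in LHS](rmorph_nat (@real_complex_def R (Phant R))) modc_pos ?ler0n. Qed.

Lemma modc_sum (I : Type) (s : seq I) (P : pred I) (F : I -> C) :
  modc (\sum_(i <- s | P i) F i) <= \sum_(i <- s | P i) modc (F i).
Proof.
elim/big_ind2: _ => [|z a w b ha hb|//]; first by rewrite modc0.
by apply: le_trans (modcD _ _) _; apply: lerD.
Qed.

Lemma modc_mul_conj z : (modc z ^+ 2)%:C%C = z * z^*.
Proof. by rewrite rmorphXn /= -modcE normCK. Qed.

(** Cauchy-Schwarz by induction on the list; the cross term is bounded by AM-GM once the two sums of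
    squares are written [rA ^+ 2] and [rB ^+ 2]. *)
Lemma sum_prod_le_sqr (I : Type) (s : seq I) (a b : I -> R) :
  (\sum_(k <- s) a k * b k) ^+ 2 <= (\sum_(k <- s) a k ^+ 2) * \sum_(k <- s) b k ^+ 2.
Proof.
elim: s => [|n s IH]; first by rewrite !big_nil expr0n mulr0.
rewrite !big_cons /=; set S := (\sum_(k <- s) _) in IH *.
set A := (\sum_(k <- s) _) in IH *; set B := (\sum_(k <- s) _) in IH *.
have A0 : 0 <= A by apply: sumr_ge0 => i _; apply: sqr_ge0.
have B0 : 0 <= B by apply: sumr_ge0 => i _; apply: sqr_ge0.
have [rA hA] : exists u, 0 <= u /\ A = u ^+ 2.
  by exists (Num.sqrt A); rewrite sqr_sqrtr // sqrtr_ge0.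
have [rB hB] : exists u, 0 <= u /\ B = u ^+ 2.
  by exists (Num.sqrt B); rewrite sqr_sqrtr // sqrtr_ge0.
case: hA => rA0 hA; case: hB => rB0 hB; rewrite hA hB in IH *.
have IH' : S <= rA * rB.
  rewrite leNgt; apply/negP => h; move: IH; rewrite leNgt -exprMn.
  by rewrite ltr_pXn2r ?nnegrE ?mulr_ge0 // ?h // (le_trans _ (ltW h)) ?mulr_ge0.
have IH'' : - (rA * rB) <= S.
  rewrite leNgt; apply/negP => h; move: IH; rewrite leNgt -exprMn -(sqrrN S).
  have h' : rA * rB < - S by lra.
  by rewrite ltr_pXn2r ?nnegrE ?mulr_ge0 // ?h' // (le_trans _ (ltW h')) ?mulr_ge0.
have h2 : 2 * S * (a n * b n) <= rA ^+ 2 * b n ^+ 2 + rB ^+ 2 * a n ^+ 2.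
  case: (lerP 0 (a n * b n)) => h.
  - have := ler_wpM2r h IH'; have := sqr_ge0 (rA * b n - rB * a n); lra.
  - have := ler_wnM2r (ltW h) IH''; have := sqr_ge0 (rA * b n + rB * a n); lra.
nra.
Qed.

Definition ell (n : nat) (x : nat -> C) : R :=
  Num.sqrt (\sum_(k < n) modc (x k) ^+ 2).

Lemma ell_ge0 n x : 0 <= ell n x.
Proof. exact: sqrtr_ge0. Qed.
Hint Resolve ell_ge0 : core.

Lemma ell_sqr n x : ell n x ^+ 2 = \sum_(k < n) modc (x k) ^+ 2.
Proof. by rewrite sqr_sqrtr // sumr_ge0 // => i _; apply: sqr_ge0. Qed.

Lemma le_ell n m x y :
  \sum_(k < n) modc (x k) ^+ 2 <= \sum_(k < m) modc (y k) ^+ 2 -> ell n x <= ell m y.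
Proof. by move=> h; apply: ler_wsqrtr. Qed.

Lemma eq_ell n x y : (forall k, (k < n)%N -> x k = y k) -> ell n x = ell n y.
Proof. by move=> h; congr Num.sqrt; apply: eq_bigr => k _; rewrite h. Qed.

Lemma ell_le n x y : (forall k, (k < n)%N -> modc (x k) <= modc (y k)) -> ell n x <= ell n y.
Proof.
move=> h; apply: le_ell; apply: ler_sum => k _.
by rewrite ler_pXn2r ?nnegrE ?h.
Qed.

Lemma ell_widen n m x : (n <= m)%N -> ell n x <= ell m x.
Proof.
move=> nm; apply: le_ell; rewrite -(subnKC nm) big_split_ord /= lerDl.
by apply: sumr_ge0 => i _; apply: sqr_ge0.
Qed.

Lemma modc_le_ell n x k : (k < n)%N -> modc (x k) <= ell n x.
Proof.
move=> kn; rewrite -(@ler_pXn2r _ 2) ?nnegrE // ell_sqr (bigD1 (Ordinal kn)) //= lerDl.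
by apply: sumr_ge0 => i _; apply: sqr_ge0.
Qed.

Lemma ell_eq0 n x : ell n x = 0 -> forall k, (k < n)%N -> x k = 0.
Proof.
move=> h k kn; have := modc_le_ell x kn; rewrite h => h'; apply/eqP.
by rewrite -modc_eq0 eq_le h' modc_ge0.
Qed.

Lemma ellZ n c x : ell n (fun k => c * x k) = modc c * ell n x.
Proof.
apply/eqP; rewrite -(@eqrXn2 _ 2) // ?mulr_ge0 //; apply/eqP.
rewrite exprMn !ell_sqr mulr_sumr; apply: eq_bigr => k _.
by rewrite modcM exprMn.
Qed.

Lemma ell_bound n x (M : R) :
  0 <= M -> (forall k, (k < n)%N -> modc (x k) <= M) -> ell n x <= Num.sqrt n%:R * M.
Proof.
move=> M0 h; rewrite -(@ler_pXn2r _ 2) ?nnegrE ?mulr_ge0 ?sqrtr_ge0 //.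
rewrite ell_sqr exprMn sqr_sqrtr ?ler0n //.
apply: (@le_trans _ _ (\sum_(k < n) M ^+ 2)).
  by apply: ler_sum => k _; rewrite ler_pXn2r ?nnegrE // h.
by rewrite sumr_const card_ord mulr_natl.
Qed.

Lemma ellN n x : ell n (fun k => - x k) = ell n x.
Proof. by congr Num.sqrt; apply: eq_bigr => k _; rewrite modcN. Qed.

Lemma sum_modcM_le n x y : \sum_(k < n) modc (x k) * modc (y k) <= ell n x * ell n y.
Proof.
rewrite -(@ler_pXn2r _ 2) ?nnegrE ?mulr_ge0 //; last by apply: sumr_ge0 => k _; apply: mulr_ge0.
by rewrite exprMn !ell_sqr; apply: sum_prod_le_sqr.
Qed.

Lemma sum_modc_le_ell n x : \sum_(k < n) modc (x k) <= Num.sqrt n%:R * ell n x.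
Proof.
have := sum_modcM_le n (fun=> 1) x; rewrite {1}/ell.
under eq_bigr do rewrite modc1 mul1r.
by under [in leRHS]eq_bigr do rewrite modc1 expr1n; rewrite sumr_const card_ord.
Qed.

Lemma ellD n x y : ell n (fun k => x k + y k) <= ell n x + ell n y.
Proof.
rewrite -(@ler_pXn2r _ 2) ?nnegrE ?addr_ge0 // sqrrD !ell_sqr.
have := sum_modcM_le n x y => h.
apply: (@le_trans _ _ (\sum_(k < n) (modc (x k) + modc (y k)) ^+ 2)).
  by apply: ler_sum => k _; rewrite ler_pXn2r ?nnegrE ?addr_ge0 // modcD.
under eq_bigr => k _ do rewrite sqrrD.
by rewrite !big_split /= lerD2r lerD2l mulr2n lerD.
Qed.

Lemma ellB n x y : ell n (fun k => x k - y k) <= ell n x + ell n y.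
Proof. by rewrite -(ellN n y); apply: ellD. Qed.

End Modulus.
#[global] Hint Extern 0 (is_true (0 <= modc _)) => solve [apply: modc_ge0] : core.
#[global] Hint Extern 0 (is_true (0 <= ell _ _)) => solve [apply: ell_ge0] : core.

(** * Polynomials modulo [X^n - 1] and the discrete Fourier transform *)

Section RootsOfUnity.
Context {R : rcfType}.
Local Notation C := R[i].
Implicit Types (f p q : {poly C}) (w : nat -> R).

Lemma exists_prim_root (n : nat) : (0 < n)%N -> exists z : C, n.-primitive_root z.
Proof.
move=> n0; have [r] := closed_field_poly_normal ('X^n - 1 : {poly C}).
rewrite (monicP (monicXnsubC 1 n0)) scale1r => factE.
have /hasP[z _ hz] : has n.-primitive_root r; last by exists z.
apply: has_prim_root => //.
- by apply/allP => z; rewrite -root_prod_XsubC -factE.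
- by rewrite -separable_prod_XsubC -factE separable_Xn_sub_1 // pnatr_eq0 -lt0n.
- by rewrite -ltnS -(size_prod_XsubC r id) -factE size_XnsubC.
Qed.

(* Reduction modulo ['X^n - 1], for polynomials of size at most [2 n]. *)
Definition wrap n p := take_poly n p + drop_poly n p.

Lemma wrapD n : {morph wrap n : p q / p + q}.
Proof. by move=> p q; rewrite /wrap take_polyD drop_polyD addrACA. Qed.

Lemma wrapZ n c : {morph wrap n : p / c *: p}.
Proof. by move=> p; rewrite /wrap take_polyZ drop_polyZ scalerDr. Qed.

Lemma size_wrap n p : (size p <= n + n)%N -> (size (wrap n p) <= n)%N.
Proof.
move=> h; apply: leq_trans (size_polyD _ _) _.
by rewrite geq_max size_take_poly size_drop_poly leq_subLR.
Qed.

Lemma size_wrapM n p q :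
  (size p <= n.+1)%N -> (size q <= n)%N -> (size (wrap n (p * q)) <= n)%N.
Proof.
move=> hp hq; apply: size_wrap; apply: leq_trans (size_polyMleq _ _) _.
have := leq_add hp hq; lia.
Qed.

Lemma wrap_horner n p z : z ^+ n = 1 -> (wrap n p).[z] = p.[z].
Proof.
by move=> zn; rewrite -[in RHS](poly_take_drop n p) /wrap !hornerE zn mulr1.
Qed.

Definition pn n p := ell n (fun k => p`_k).
Definition wn n w p := ell n (fun k => (w k)%:C%C * p`_k).

Lemma pn_ge0 n p : 0 <= pn n p.
Proof. exact: ell_ge0. Qed.

Lemma wn_ge0 n w p : 0 <= wn n w p.
Proof. exact: ell_ge0. Qed.

Section Fourier.
Variables (n : nat) (z : C).
Hypotheses (n0 : (0 < n)%N) (hz : n.-primitive_root z).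

Lemma modc_prim : modc z = 1.
Proof.
apply/eqP; rewrite -(@eqrXn2 _ n) ?modc_ge0 // expr1n -modcX (prim_expr_order hz).
by rewrite modc1.
Qed.

Lemma modc_prim_exp k : modc (z ^+ k) = 1.
Proof. by rewrite modcX modc_prim expr1n. Qed.

Lemma prim_unit : z != 0.
Proof. by rewrite -modc_eq0 modc_prim oner_eq0. Qed.

Lemma prim_exp_order k : (z ^+ k) ^+ n = 1.
Proof. by rewrite exprAC (prim_expr_order hz) expr1n. Qed.

Lemma conj_prim_exp k : (z ^+ k)^* = z ^- k.
Proof.
apply: (mulfI (expf_neq0 k prim_unit)).
by rewrite divff ?expf_neq0 ?prim_unit // -modc_mul_conj modc_prim_exp expr1n.
Qed.

(** Orthogonality of characters: for distinct [k] and [l] the ratio is an [n]-th root of unity other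
    than 1, so the geometric sum vanishes. *)
Lemma sum_prim_exp k l : (k < n)%N -> (l < n)%N ->
  \sum_(j < n) (z ^+ k / z ^+ l) ^+ j = (n * (k == l))%:R.
Proof.
move=> kn ln; have [->|kl] := eqVneq k l.
  rewrite divff ?expf_neq0 ?prim_unit //.
  under eq_bigr => j _ do rewrite expr1n.
  by rewrite sumr_const card_ord muln1.
have h : z ^+ k / z ^+ l != 1.
  apply: contra_neq kl => h; apply/eqP.
  have : z ^+ k == z ^+ l by rewrite -(divfK (expf_neq0 l prim_unit) (z ^+ k)) h mul1r.
  by rewrite (eq_prim_root_expr hz) !modn_small.
rewrite muln0; apply/eqP; have /eqP := subrX1 (z ^+ k / z ^+ l) n.
rewrite exprMn exprVn !prim_exp_order invr1 mulr1 subrr eq_sym mulf_eq0 subr_eq0.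
by rewrite (negPf h).
Qed.

(** Expanding the squared modulus gives a double sum over coefficients, of which orthogonality of
    characters leaves [n] times the diagonal. *)
Lemma parseval p : (size p <= n)%N ->
  \sum_(j < n) modc p.[z ^+ j] ^+ 2 = n%:R * pn n p ^+ 2.
Proof.
move=> sp; apply: complexI; rewrite rmorph_sum rmorphM rmorph_nat /= ell_sqr rmorph_sum /=.
transitivity (\sum_(j < n) \sum_(k < n) \sum_(l < n)
    (p`_k * (p`_l)^*) * (z ^+ k / z ^+ l) ^+ j).
  apply: eq_bigr => j _; rewrite modc_mul_conj (horner_coef_wide _ sp) rmorph_sum.
  rewrite big_distrlr /=; apply: eq_bigr => k _; apply: eq_bigr => l _.
  rewrite rmorphM /= -!exprM conj_prim_exp exprMn exprVn -!exprM mulrACA.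
  by rewrite (mulnC j) (mulnC j).
rewrite exchange_big mulr_sumr /=; apply: eq_bigr => k _.
rewrite exchange_big (bigD1 k) //= [X in _ + X]big1 ?addr0.
  by rewrite -mulr_sumr sum_prim_exp // eqxx muln1 -modc_mul_conj mulrC.
move=> l lk; rewrite -mulr_sumr sum_prim_exp //.
by rewrite (_ : (k == l :> nat) = false) ?muln0 ?mulr0 // eq_sym; apply: negbTE.
Qed.

Lemma pn_eq0 p : (size p <= n)%N -> pn n p = 0 -> p = 0.
Proof.
move=> sp h; apply/polyP => k; rewrite coef0; case: (ltnP k n) => kn.
  exact: (ell_eq0 h kn).
by rewrite nth_default // (leq_trans sp).
Qed.

Lemma horner_inj p q : (size p <= n)%N -> (size q <= n)%N ->
  (forall j, (j < n)%N -> p.[z ^+ j] = q.[z ^+ j]) -> p = q.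
Proof.
move=> sp sq h; apply/eqP; rewrite -subr_eq0; apply/eqP.
have spq : (size (p - q)%R <= n)%N.
  by apply: leq_trans (size_polyD _ _) _; rewrite size_polyN geq_max sp.
apply: pn_eq0 => //; apply/eqP; rewrite -sqrf_eq0.
have /eqP := parseval spq; rewrite big1; last first.
  by move=> j _; rewrite !hornerE h // subrr modc0 expr0n.
by rewrite eq_sym mulf_eq0 pnatr_eq0 eqn0Ngt n0.
Qed.

(** Inverse Fourier transform of the indicator of [i]: the Lagrange interpolation polynomial at
    [z ^+ i], an idempotent modulo [X^n - 1]. *)
Definition idem i : {poly C} := \poly_(k < n) (n%:R^-1 / z ^+ (i * k)).

Lemma size_idem i : (size (idem i) <= n)%N.
Proof. exact: size_poly. Qed.

Lemma idem_horner i j : (i < n)%N -> (j < n)%N -> (idem i).[z ^+ j] = (i == j)%:R.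
Proof.
move=> hi hj; rewrite (horner_coef_wide _ (size_idem i)).
transitivity (n%:R^-1 * \sum_(k < n) (z ^+ j / z ^+ i) ^+ k).
  rewrite mulr_sumr; apply: eq_bigr => k _; rewrite coef_poly ltn_ord -mulrA; congr (_ * _).
  by rewrite exprMn exprVn -!exprM mulrC.
rewrite sum_prim_exp // natrM mulrA mulVf ?mul1r ?pnatr_eq0 -?lt0n //.
by rewrite eq_sym.
Qed.

Lemma sum_idem p : (size p <= n)%N -> p = \sum_(i < n) p.[z ^+ i] *: idem i.
Proof.
move=> sp; apply: horner_inj => //.
  apply: leq_trans (size_sum _ _ _) _; apply/bigmax_leqP => i _.
  by apply: leq_trans (size_scale_leq _ _) (size_idem i).
move=> j jn; rewrite horner_sum (bigD1 (Ordinal jn)) //= hornerZ idem_horner // eqxx mulr1.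
rewrite big1 ?addr0 // => i ij; rewrite hornerZ idem_horner //.
by rewrite (_ : (i == j :> nat) = false) ?mulr0 //; apply: negbTE.
Qed.

(* On values at the roots of unity, [wrap n (f * p)] is the pointwise product. *)
Lemma pn_wrap_ge f p (d : R) : 0 <= d -> (size f <= n.+1)%N -> (size p <= n)%N ->
  (forall j, (j < n)%N -> d <= modc f.[z ^+ j]) -> d * pn n p <= pn n (wrap n (f * p)).
Proof.
move=> d0 sf sp h; rewrite -(@ler_pXn2r _ 2) ?nnegrE ?mulr_ge0 ?ell_ge0 //.
rewrite -(@ler_pM2l _ n%:R) ?ltr0n // exprMn mulrCA -!parseval ?size_wrapM //.
rewrite mulr_sumr; apply: ler_sum => j _.
rewrite wrap_horner ?prim_exp_order // hornerM modcM exprMn ler_wpM2r ?sqr_ge0 //.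
by rewrite ler_pXn2r ?h ?nnegrE ?modc_ge0.
Qed.

Lemma pn_wrap_le f p (d : R) : 0 <= d -> (size f <= n.+1)%N -> (size p <= n)%N ->
  (forall j, (j < n)%N -> modc f.[z ^+ j] <= d) -> pn n (wrap n (f * p)) <= d * pn n p.
Proof.
move=> d0 sf sp h; rewrite -(@ler_pXn2r _ 2) ?nnegrE ?mulr_ge0 ?ell_ge0 //.
rewrite -(@ler_pM2l _ n%:R) ?ltr0n // exprMn [leRHS]mulrCA -!parseval ?size_wrapM //.
rewrite mulr_sumr; apply: ler_sum => j _.
rewrite wrap_horner ?prim_exp_order // hornerM modcM exprMn ler_wpM2r ?sqr_ge0 //.
by rewrite ler_pXn2r ?h ?nnegrE ?modc_ge0.
Qed.

End Fourier.
End RootsOfUnity.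
#[global] Hint Extern 0 (is_true (0 <= pn _ _)) => solve [apply: pn_ge0] : core.
#[global] Hint Extern 0 (is_true (0 <= wn _ _ _)) => solve [apply: wn_ge0] : core.

(** * Truncated products and the derivation [X d/dX] *)

Section TruncatedProducts.
Context {R : rcfType}.
Local Notation C := R[i].
Implicit Types (f g p q F : {poly C}) (w : nat -> R) (n : nat).

Lemma wnD n w p q : wn n w (p + q) <= wn n w p + wn n w q.
Proof.
rewrite /wn; under [leLHS]eq_ell do rewrite coefD mulrDr.
exact: ellD.
Qed.

Lemma wnZ n w c p : wn n w (c *: p) = modc c * wn n w p.
Proof.
by rewrite /wn -ellZ; apply: eq_ell => k _; rewrite coefZ mulrCA.
Qed.

Lemma wnB n w p q : wn n w (p - q) <= wn n w p + wn n w q.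
Proof.
rewrite /wn; under [leLHS]eq_ell do rewrite coefB mulrBr.
exact: ellB.
Qed.

Lemma pn_wn n p : pn n p = wn n (fun=> 1) p.
Proof. by apply: eq_ell => k _; rewrite mul1r. Qed.

Lemma pnD n p q : pn n (p + q) <= pn n p + pn n q.
Proof. by rewrite !pn_wn wnD. Qed.

Lemma pnB n p q : pn n (p - q) <= pn n p + pn n q.
Proof. by rewrite !pn_wn wnB. Qed.

(** Coefficients of degree below [n] of a product depend only on such coefficients of the factors,
    so truncated multiplications compose and commute. *)
Lemma take_poly_mul_take n p q : take_poly n (p * take_poly n q) = take_poly n (p * q).
Proof.
apply/polyP => k; rewrite !coef_take_poly; case: ifP => // kn.
rewrite !coefM; apply: eq_bigr => j _; rewrite coef_take_poly.
by rewrite ifT // (leq_ltn_trans (leq_subr _ _) kn).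
Qed.

(** The Euler operator, a derivation that is diagonal on monomials and therefore commutes with
    truncation. *)
Definition xderiv p : {poly C} := 'X * p^`().

Lemma coef_xderiv p k : (xderiv p)`_k = k%:R * p`_k.
Proof.
rewrite /xderiv coefXM; case: k => [|k] /=; first by rewrite mul0r.
by rewrite coef_deriv mulr_natl.
Qed.

Lemma xderivM p q : xderiv (p * q) = xderiv p * q + p * xderiv q.
Proof. by rewrite /xderiv derivM mulrDr mulrA (mulrCA 'X). Qed.

Lemma xderiv_take n p : xderiv (take_poly n p) = take_poly n (xderiv p).
Proof.
apply/polyP => k; rewrite coef_xderiv !coef_take_poly; case: ifP => _; last by rewrite mulr0.
by rewrite coef_xderiv.
Qed.

(** The norm with this weight is equivalent to [pn n p + gam * pn n (xderiv p)], which turns a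
    weighted estimate into two plain ones. *)
Definition lin_weight (gam : R) k := 1 + gam * k%:R.

Section LinearWeight.
Variables (gam : R) (gam0 : 0 < gam).
Local Notation a := (lin_weight gam).

Lemma lin_weight_ge1 k : 1 <= a k.
Proof. by rewrite lerDl mulr_ge0 // ltW. Qed.

Lemma lin_weight_ge0 k : 0 <= a k.
Proof. exact: le_trans ler01 (lin_weight_ge1 k). Qed.

Lemma modc_lin_weightM k (c : C) : modc ((a k)%:C%C * c) = a k * modc c.
Proof. by rewrite modcM modc_pos // lin_weight_ge0. Qed.

Lemma pn_le_wn n p : pn n p <= wn n a p.
Proof.
apply: ell_le => k _; rewrite modc_lin_weightM ler_peMl ?lin_weight_ge1 //.
Qed.

Lemma pn_xderiv_le n p : gam * pn n (xderiv p) <= wn n a p.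
Proof.
rewrite -[X in X * _](modc_pos (ltW gam0)) /pn -ellZ; apply: ell_le => k _.
rewrite coef_xderiv mulrA modcM modc_lin_weightM ler_wpM2r //.
by rewrite modcM modc_pos ?modc_nat ?lerDr // ltW.
Qed.

Lemma wn_le_pn_xderiv n p : wn n a p <= pn n p + gam * pn n (xderiv p).
Proof.
rewrite -[X in _ + X * _](modc_pos (ltW gam0)) /pn -ellZ; apply: le_trans (ellD _ _ _).
apply: ell_le => k _; rewrite coef_xderiv.
by rewrite /lin_weight rmorphD rmorphM rmorph1 rmorph_nat mulrDl mul1r mulrA.
Qed.

(* [xderiv] is a derivation, so an element of the commutative algebra of truncated
   multiplications that is bounded below on unweighted coefficients is bounded
   below in the weighted norm as well. *)
Lemma take_mul_lower_bound n (eta : R) F p : 0 < eta ->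
  (forall q, (size q <= n)%N -> eta * pn n q <= pn n (take_poly n (F * q))) ->
  (forall q, (size q <= n)%N -> pn n (take_poly n (F * q)) <= 3 * pn n q) ->
  (forall q, (size q <= n)%N -> wn n a (take_poly n (F * q)) <= 2 * wn n a q) ->
  (size p <= n)%N ->
  wn n a p <= (2 + 5 / eta) / eta * wn n a (take_poly n (F * p)).
Proof.
move=> eta0 h1 h2 h3 sp; set L := fun q => take_poly n (F * q).
set g := take_poly n (F * p); pose r := take_poly n (xderiv F * p).
have sz q : (size (take_poly n q) <= n)%N by exact: size_take_poly.
have szD q : (size q <= n)%N -> (size (xderiv q) <= n)%N.
  move=> sq; apply/leq_sizeP => j nj; rewrite coef_xderiv nth_default ?mulr0 //.
  exact: leq_trans nj.
have LD : L (xderiv p) = xderiv g - r.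
  rewrite /L /g /r xderiv_take xderivM take_polyD addrAC subrr add0r //.
(* A second application of [L] eliminates [p]: by commutativity [L r] is the truncated product of
   [xderiv F] and [g], which Leibniz expresses through [g] alone. The constant 5 below is 2 from
   [h3] plus 3 from [h2]. *)
have Lr : L r = xderiv (L g) - L (xderiv g).
  by rewrite /L xderiv_take xderivM take_polyD addrK /g /r !take_poly_mul_take mulrCA.
have sg : (size g <= n)%N by exact: sz.
have Hr : gam * pn n (L r) <= 5 * wn n a g.
  rewrite Lr; apply: (@le_trans _ _ (gam * pn n (xderiv (L g)) + gam * pn n (L (xderiv g)))).
    by rewrite -mulrDr ler_wpM2l ?pnB // ltW.
  have := h2 _ (szD _ sg); rewrite -(ler_pM2l gam0) => h2'.
  have := pn_xderiv_le n (L g); have := pn_xderiv_le n g; have := h3 _ sg; rewrite -/(L g).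
  lra.
have Hr' : gam * pn n r <= 5 / eta * wn n a g.
  have := h1 _ (sz (xderiv F * p)); rewrite -/r -/(L r) -(ler_pM2l gam0) => h.
  by rewrite mulrAC ler_pdivlMr // mulrC mulrCA (le_trans h).
have Hx : eta * (gam * pn n (xderiv p)) <= (1 + 5 / eta) * wn n a g.
  have h : eta * pn n (xderiv p) <= pn n (xderiv g) + pn n r.
    by apply: le_trans (h1 _ (szD _ sp)) _; rewrite -/(L _) LD pnB.
  rewrite mulrCA mulrDl mul1r; apply: le_trans (ler_wpM2l (ltW gam0) h) _.
  by rewrite mulrDr lerD // pn_xderiv_le.
have Hp : eta * pn n p <= wn n a g by apply: le_trans (h1 _ sp) (pn_le_wn _ _).
have := wn_le_pn_xderiv n p; rewrite -(ler_pM2l eta0) mulrDr => h.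
rewrite mulrAC ler_pdivlMr // mulrC (le_trans h) //; lra.
Qed.

End LinearWeight.
End TruncatedProducts.

(** * The part of a product modulo [X^n - 1] that wraps around *)

Section WrappedPart.
Context {R : rcfType}.
Local Notation C := R[i].
Implicit Types (f p F : {poly C}) (w : nat -> R) (n : nat).

(** Terms with [j <= l] meet a coefficient of [p] of degree at least [n], and terms with [j >= n]
    such a coefficient of [F]; for [l >= n] nothing is left. *)
Lemma coefM_wrapped n F p l : (size F <= n)%N -> (size p <= n)%N ->
  (F * p)`_(n + l) = \sum_(l.+1 <= j < n) F`_j * p`_(n + l - j).
Proof.
move=> sF sp; rewrite coefM -(big_mkord xpredT (fun j => F`_j * p`_(n + l - j))).
have nth0 (q : {poly C}) k : (size q <= n)%N -> (n <= k)%N -> q`_k = 0.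
  by move=> sq nk; rewrite nth_default // (leq_trans sq).
have [ln|nl] := ltnP l n.
  rewrite (@big_cat_nat _ _ _ l.+1) //=; last by rewrite ltnS leq_addl.
  rewrite (@big_cat_nat _ _ _ n l.+1) //=; last by rewrite leqW // leq_addr.
  rewrite big_nat big1 ?add0r; last first.
    by move=> j /andP[_ jl]; rewrite (nth0 p) ?mulr0 //; lia.
  rewrite [X in _ + X]big_nat [X in _ + X]big1 ?addr0 //.
  by move=> j /andP[nj _]; rewrite (nth0 F) ?mul0r.
rewrite [RHS]big_geq ?leqW // big_nat big1 // => j _.
case: (leqP n j) => nj; first by rewrite (nth0 F) ?mul0r.
by rewrite (nth0 p) ?mulr0 //; lia.
Qed.

Lemma sum_rev_wrapped n l (G : nat -> R) :
  \sum_(l.+1 <= j < n) G (n + l - j)%N = \sum_(l.+1 <= j < n) G j.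
Proof.
rewrite [RHS]big_nat_rev /=; apply: eq_big_nat => j /andP[h1 h2]; congr G; lia.
Qed.

Lemma sum_wrapped_le n l (G : nat -> R) : (forall j, 0 <= G j) ->
  \sum_(l.+1 <= j < n) G j <= \sum_(j < n) G j.
Proof.
move=> G0; rewrite -(big_mkord xpredT G); case: (ltnP l n) => ln; last first.
  rewrite [leLHS]big_geq ?(leqW ln) //; apply: sumr_ge0 => j _; apply: G0.
by rewrite [leRHS](@big_cat_nat _ _ _ l.+1) //= lerDr sumr_ge0.
Qed.

(* [p |-> drop_poly n (F * p)] is the Hankel-type part of multiplication modulo
   ['X^n - 1]; the sum on the right is its squared Hilbert-Schmidt norm. *)
Lemma pn_drop_le n F p : (size F <= n)%N -> (size p <= n)%N ->
  pn n (drop_poly n (F * p)) ^+ 2 <= (\sum_(j < n) j%:R * modc F`_j ^+ 2) * pn n p ^+ 2.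
Proof.
move=> sF sp; rewrite ell_sqr.
apply: (@le_trans _ _ (\sum_(l < n) (\sum_(l.+1 <= j < n) modc F`_j ^+ 2) * pn n p ^+ 2)).
  apply: ler_sum => l _; rewrite coef_drop_poly addnC coefM_wrapped //.
  apply: (@le_trans _ _ ((\sum_(l.+1 <= j < n) modc F`_j * modc p`_(n + l - j)) ^+ 2)).
    rewrite ler_pXn2r ?nnegrE ?sumr_ge0 // => [|j _]; last by rewrite mulr_ge0.
    by apply: le_trans (modc_sum _ _ _) _; apply: ler_sum => j _; rewrite modcM.
  apply: le_trans (sum_prod_le_sqr _ _ _) _.
  rewrite ler_wpM2l ?sumr_ge0 // => [j _|]; first exact: sqr_ge0.
  rewrite (sum_rev_wrapped n l (fun j => modc p`_j ^+ 2)) /pn ell_sqr.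
  by apply: (sum_wrapped_le n l) => j; apply: sqr_ge0.
rewrite -mulr_suml ler_wpM2r ?sqr_ge0 //.
(* After the exchange of sums, index [j] is counted once for each [l < j], hence the factor [j]. *)
have -> : \sum_(l < n) \sum_(l.+1 <= j < n) modc F`_j ^+ 2 =
          \sum_(l < n) \sum_(j < n) (if (l < j)%N then modc F`_j ^+ 2 else 0).
  apply: eq_bigr => l _; rewrite -(big_mkord xpredT (fun j => if (l < j)%N then modc F`_j ^+ 2 else 0)).
  rewrite [RHS](@big_cat_nat _ _ _ l.+1) //= [X in _ = X + _]big_nat [X in _ = X + _]big1 ?add0r.
    by apply: eq_big_nat => j /andP[-> _].
  by move=> j /andP[_ jl]; rewrite ifF //; lia.
rewrite exchange_big /=; apply: ler_sum => j _.
rewrite -big_mkcond -(big_ord_widen n (fun=> modc F`_j ^+ 2) (ltnW (ltn_ord j))) /=.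
by rewrite sumr_const card_ord mulr_natl.
Qed.

(** The inequality [gam n a_l <= a_j a_(n+l-j)] for [l < j < n] and Cauchy-Schwarz bound each
    weighted coefficient by [1 / (gam n)] times the product of the norms; the [n] coefficients
    together cost a factor [sqrt n]. *)
Lemma wn_drop_le n gam F p : (0 < n)%N -> 0 < gam -> (size F <= n)%N -> (size p <= n)%N ->
  wn n (lin_weight gam) (drop_poly n (F * p)) <=
  (gam * Num.sqrt n%:R)^-1 * (wn n (lin_weight gam) F * wn n (lin_weight gam) p).
Proof.
move=> n0 g0 sF sp; set a := lin_weight gam; set M := wn n a F * wn n a p.
have M0 : 0 <= M by rewrite mulr_ge0.
have gn0 : 0 < gam * n%:R by rewrite mulr_gt0 ?ltr0n.
have sn0 : 0 < Num.sqrt n%:R :> R by rewrite sqrtr_gt0 ltr0n.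
have -> : (gam * Num.sqrt n%:R)^-1 = Num.sqrt n%:R * (gam * n%:R)^-1.
  rewrite -[X in _ * (_ * X)^-1](@sqr_sqrtr _ n%:R) ?ler0n //; field.
  by rewrite !gt_eqF.
rewrite -mulrA; apply: ell_bound => [|l ln]; first by rewrite mulr_ge0 // invr_ge0 ltW.
rewrite (modc_lin_weightM g0) coef_drop_poly addnC coefM_wrapped //.
apply: (@le_trans _ _ ((gam * n%:R)^-1 *
   \sum_(l.+1 <= j < n) (a j * modc F`_j) * (a (n + l - j)%N * modc p`_(n + l - j)))).
  apply: le_trans (ler_wpM2l (lin_weight_ge0 g0 l) (modc_sum _ _ _)) _.
  rewrite !mulr_sumr !big_nat; apply: ler_sum => j /andP[lj jn].
  rewrite modcM [X in _ <= _ * X]mulrACA [leRHS]mulrA ler_wpM2r ?mulr_ge0 // ler_pdivlMl // /a /lin_weight.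
  have -> : n%:R = (n - j)%N%:R + j%:R :> R by rewrite -natrD subnK // ltnW.
  have -> : j%:R = (j - l)%N%:R + l%:R :> R by rewrite -natrD subnK // ltnW.
  have -> : (n + l - j)%N%:R = (n - j)%N%:R + l%:R :> R by rewrite -natrD addnBAC // ltnW.
  move: (ler0n R (n - j)) (ler0n R (j - l)) (ler0n R l).
  set x := (_%:R : R); set y := (_%:R : R); set z := (_%:R : R) => x0 y0 z0.
  have := mulr_ge0 (ltW g0) x0; have := mulr_ge0 (ltW g0) z0; have := mulr_ge0 (ltW g0) y0.
  have := mulr_ge0 (mulr_ge0 (ltW g0) (ltW g0)) (mulr_ge0 x0 y0).
  nra.
rewrite ler_wpM2l ?invr_ge0 ?(ltW gn0) //.
rewrite -(@ler_pXn2r _ 2) ?nnegrE //; last by apply: sumr_ge0 => j _; rewrite !mulr_ge0 ?lin_weight_ge0.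
apply: le_trans (sum_prod_le_sqr _ _ _) _; rewrite exprMn !ell_sqr.
rewrite (sum_rev_wrapped n l (fun j => (a j * modc p`_j) ^+ 2)).
rewrite ler_pM ?sumr_ge0 // => [j _|j _||]; try exact: sqr_ge0.
- apply: le_trans (sum_wrapped_le n l (G := fun j => (a j * modc F`_j) ^+ 2) _) _ => [j|].
    exact: sqr_ge0.
  by apply: ler_sum => j _; rewrite (modc_lin_weightM g0).
- apply: le_trans (sum_wrapped_le n l (G := fun j => (a j * modc p`_j) ^+ 2) _) _ => [j|].
    exact: sqr_ge0.
  by apply: ler_sum => j _; rewrite (modc_lin_weightM g0).
Qed.

End WrappedPart.

(** * Lower bound on a block with a constant free of the block length *)

Section BlockLowerBound.
Context {R : rcfType}.
Local Notation C := R[i].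
Implicit Types (f p q F : {poly C}) (w : nat -> R) (n : nat).

(** The polynomial [p(c X)]. Dilation by the radius carries the norm of weight [bweight] to that of
    weight [lin_weight]. *)
Definition dilate (c : C) p : {poly C} := \poly_(k < size p) (c ^+ k * p`_k).

Lemma coef_dilate c p k : (dilate c p)`_k = c ^+ k * p`_k.
Proof. by rewrite coef_poly; case: ltnP => // h; rewrite nth_default ?mulr0. Qed.

Lemma size_dilate c p : (size (dilate c p) <= size p)%N.
Proof. exact: size_poly. Qed.

Lemma dilateM c p q : dilate c (p * q) = dilate c p * dilate c q.
Proof.
apply/polyP => k; rewrite coef_dilate !coefM mulr_sumr; apply: eq_bigr => j _.
by rewrite !coef_dilate mulrACA -exprD subnKC // -ltnS.
Qed.

Lemma dilateK c p : c != 0 -> dilate c (dilate c^-1 p) = p.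
Proof.
move=> c0; apply/polyP => k; rewrite !coef_dilate mulrA -exprMn divff // expr1n mul1r //.
Qed.

Definition bweight (gam Rr : R) k := lin_weight gam k * Rr ^+ k.

Lemma wn_dilate n gam Rr p :
  wn n (lin_weight gam) (dilate Rr%:C%C p) = wn n (bweight gam Rr) p.
Proof.
by apply: eq_ell => k _; rewrite coef_dilate mulrA /bweight rmorphM rmorphXn.
Qed.

Lemma wn1 n w : (0 < n)%N -> w 0%N = 1 -> wn n w 1 = 1.
Proof.
case: n => // n _ w0; rewrite /wn /ell big_ord_recl big1 => [|k _].
  by rewrite coef1 w0 mulr1 modc1 expr1n addr0 sqrtr1.
by rewrite coef1 mulr0 modc0 expr0n.
Qed.

(** Serves to compare a multiplier with its dilation [F]: their coefficients differ by at most
    [Rr - 1] times those of [xderiv F]. *)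
Lemma sub1_exp_le (x : R) k : 1 <= x -> x ^+ k - 1 <= (x - 1) * (k%:R * x ^+ k).
Proof.
move=> x1; rewrite subrX1 ler_wpM2l ?subr_ge0 //.
apply: (@le_trans _ _ (\sum_(i < k) x ^+ k)).
  by apply: ler_sum => i _; rewrite ler_weXn2l // ltnW.
by rewrite sumr_const card_ord mulr_natl.
Qed.

(* In the coordinates [R^k f_k], multiplication by [f] modulo ['X^n - 1] is [L + rho N]
   with [L] lower triangular Toeplitz, [N] the wrapped part and [rho = R^-n]. On
   unweighted coefficients, [L] is within [eta + dl] of the multiplication by [f]
   modulo ['X^n - 1], which is bounded below by [dp]: the contraction hypothesis,
   applied to [1], bounds [sum j |F_j|^2] by [dl^2]. The derivation argument then
   bounds [L] below in the weighted norm, in which [N] is negligible. *)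
Lemma block_lower_bound n (z : C) (dl dp gam Rr : R) f p :
  let eta := (dp - dl) / 2 in let K := (2 + 5 / eta) / eta in
  let w := bweight gam Rr in
  (0 < n)%N -> n.-primitive_root z -> 0 < dl -> dl < dp -> 0 < gam -> 1 <= Rr ->
  dl * (1 + gam) * Rr = 1 ->
  (Rr - 1) / gam * Num.sqrt n%:R <= eta -> 1 - Rr ^- 2 <= dp ^+ 2 - dl ^+ 2 ->
  (gam * Num.sqrt n%:R)^-1 <= 1 -> K * (gam * Num.sqrt n%:R)^-1 <= 1 / 2 ->
  (size f <= n)%N -> (forall j, (j < n)%N -> dp <= modc f.[z ^+ j] <= 1) ->
  (forall q, (size q <= n)%N -> wn n w (wrap n (f * q)) <= wn n w q) ->
  (size p <= n)%N -> wn n w p <= 2 * K * wn n w (wrap n (f * p)).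
Proof.
move=> eta K w n0 hz dl0 dldp g0 R1 hdR hRn hRd hnu hK sf fz hT sp.
have R0 : 0 < Rr by exact: lt_le_trans ltr01 R1.
have Rc0 : Rr%:C%C != 0 by rewrite -modc_eq0 modc_pos ?gt_eqF // ltW.
have eta0 : 0 < eta by rewrite /eta; lra.
have K0 : 0 < K by rewrite divr_gt0 // addr_gt0 // divr_gt0.
have dp1 : dp <= 1 by case/andP: (fz 0%N n0) => h1 h2; apply: le_trans h2.
set a := lin_weight gam; set nu := (gam * Num.sqrt n%:R)^-1 in hnu hK.
have nu0 : 0 <= nu by rewrite invr_ge0 mulr_ge0 ?sqrtr_ge0 // ltW.
set F := dilate Rr%:C%C f.
have sF : (size F <= n)%N by apply: leq_trans (size_dilate _ _) sf.
pose L q := take_poly n (F * q); pose N q := drop_poly n (F * q).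
pose rho := Rr ^- n.
have rho1 : 0 <= rho <= 1.
  by rewrite invr_ge0 exprn_ge0 ?(ltW R0) //= invf_le1 ?exprn_gt0 // exprn_ege1.
(* A coefficient of degree [n + k] moved down to degree [k] is scaled by [Rr ^+ k] instead of
   [Rr ^+ (n + k)], hence the factor [rho]. *)
have wrapE q : dilate Rr%:C%C (take_poly n (wrap n (f * q))) =
    L (dilate Rr%:C%C q) + rho%:C%C *: take_poly n (N (dilate Rr%:C%C q)).
  apply/polyP => k; rewrite coef_dilate coefD coefZ !coef_take_poly.
  case: ifP => kn; last by rewrite !mulr0 addr0.
  rewrite /wrap coefD coef_take_poly kn /N !coef_drop_poly -dilateM !coef_dilate mulrDr.
  congr (_ + _); rewrite mulrA exprD fmorphV rmorphXn /=; congr (_ * _).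
  by rewrite mulrCA mulVf ?expf_neq0 // mulr1.
have wn_take q : wn n a (take_poly n q) = wn n a q.
  by apply: eq_ell => k kn; rewrite coef_take_poly kn.
have wnE q : wn n w (wrap n (f * q)) =
    wn n a (L (dilate Rr%:C%C q) + rho%:C%C *: N (dilate Rr%:C%C q)).
  transitivity (wn n a (dilate Rr%:C%C (take_poly n (wrap n (f * q))))).
    rewrite wn_dilate; apply: eq_ell => k kn; by rewrite coef_take_poly kn.
  rewrite wrapE; apply: eq_ell => k kn.
  by rewrite !coefD !coefZ [in LHS]coef_take_poly [X in _ * (_ + _ * X)]coef_take_poly kn coef_take_poly kn.
have hT' (y : {poly C}) : (size y <= n)%N -> wn n a (L y + rho%:C%C *: N y) <= wn n a y.
  move=> sy; rewrite -(dilateK y Rc0) -wnE wn_dilate; apply: hT.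
  exact: leq_trans (size_dilate _ _) sy.
have wnF : wn n a F <= 1.
  have := hT' 1 _; rewrite size_poly1 => /(_ n0); rewrite /L /N mulr1.
  rewrite take_poly_id // drop_poly_eq0 // scaler0 addr0 wn1 //.
  by rewrite /a /lin_weight mulr0 addr0.
have HN q : (size q <= n)%N -> wn n a (N q) <= nu * wn n a q.
  move=> sq; apply: le_trans (wn_drop_le n0 g0 sF sq) _.
  by rewrite ler_wpM2l // ler_piMl.
(* Area bound: Parseval gives [dp <= pn n f <= pn n F], the contraction gives [wn n a F <= 1], and
   [(1 + gam j)^2 >= 1 + (2 gam + gam^2) j] compares the two norms. *)
have HE : \sum_(j < n) j%:R * modc F`_j ^+ 2 <= dl ^+ 2.
  have pnf : dp <= pn n f.
    have := pn_wrap_ge n0 hz (p := 1) (f := f) (d := dp); rewrite mulr1 size_poly1.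
    rewrite (pn_wn _ 1) wn1 // mulr1 /wrap take_poly_id // drop_poly_eq0 // addr0.
    apply=> //; [by apply: ltW; apply: lt_trans dldp|exact: leqW|].
    by move=> j jn; case/andP: (fz _ jn).
  have pnF : dp ^+ 2 <= pn n F ^+ 2.
    rewrite ler_pXn2r ?nnegrE // ?(le_trans pnf) // ?(le_trans (ltW dl0) (ltW dldp)) //.
    apply: ell_le => k kn; rewrite coef_dilate modcM modcX modc_pos ?(ltW R0) //.
    by rewrite ler_peMl // exprn_ege1.
  have c0 : 0 < 2 * gam + gam ^+ 2 by rewrite addr_gt0 ?exprn_gt0 // mulr_gt0.
  have wnF2 : wn n a F ^+ 2 <= 1 by rewrite expr_le1.
  have : pn n F ^+ 2 + (2 * gam + gam ^+ 2) * (\sum_(j < n) j%:R * modc F`_j ^+ 2)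
      <= wn n a F ^+ 2.
    rewrite !ell_sqr mulr_sumr -big_split /=; apply: ler_sum => j _.
    rewrite (modc_lin_weightM g0) exprMn mulrA -[X in X + _]mul1r -mulrDl ler_wpM2r ?sqr_ge0 //.
    have : (j%:R : R) <= j%:R ^+ 2.
      by rewrite -natrX ler_nat; case: (nat_of_ord j) => // m; rewrite leq_pmulr.
    have := sqr_ge0 gam; rewrite /a /lin_weight; move: (j%:R : R) => t; nra.
  move=> hE; rewrite -(ler_pM2l c0).
  (* With this value of [1 / Rr], [hRd] becomes [1 - dp^2 <= dl^2 (2 gam + gam^2)]. *)
  have Rinv : Rr^-1 = dl * (1 + gam) by rewrite -[RHS](mulfK (lt0r_neq0 R0)) hdR mul1r.
  move: hRd; rewrite -exprVn Rinv => hRd'; nra.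
(* At a root of unity [F - f] is at most [Rr - 1] times the sum of the [|k F_k|], which
   Cauchy-Schwarz and [wn n a F <= 1] bound by [sqrt n / gam]. *)
have HFf q : (size q <= n)%N -> pn n (wrap n ((F - f) * q)) <= eta * pn n q.
  move=> sq; apply: (pn_wrap_le n0 hz) => //; first exact: ltW.
    apply: leq_trans (size_polyD _ _) _; rewrite size_polyN geq_max.
    by rewrite !leqW.
  move=> j jn; rewrite (@horner_coef_wide _ n); last first.
    by apply: leq_trans (size_polyD _ _) _; rewrite size_polyN geq_max sF.
  apply: le_trans (modc_sum _ _ _) _.
  apply: (@le_trans _ _ ((Rr - 1) * \sum_(k < n) modc (xderiv F)`_k)).
    rewrite mulr_sumr; apply: ler_sum => k _.
    rewrite modcM modcX (modc_prim_exp n0 hz) expr1n mulr1 coefB coef_xderiv !coef_dilate.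
    rewrite -[X in _ - X]mul1r -mulrBl !modcM modc_nat !mulrA ler_wpM2r //.
    rewrite -[X in modc (X - _)](rmorphXn _ k) -(rmorph1 (real_complex_def (Phant R))) -rmorphB.
    rewrite !modc_pos ?subr_ge0 ?exprn_ege1 ?exprn_ge0 ?(ltW R0) // -mulrA.
    by rewrite modcX modc_pos ?(ltW R0) //; apply: sub1_exp_le.
  apply: le_trans hRn; rewrite -mulrA ler_wpM2l ?subr_ge0 //.
  apply: le_trans (sum_modc_le_ell _ _) _; rewrite mulrC ler_wpM2r ?sqrtr_ge0 //.
  by rewrite -div1r ler_pdivlMr // mulrC (le_trans (pn_xderiv_le g0 n F)).
have pnN q : (size q <= n)%N -> pn n (N q) <= dl * pn n q.
  move=> sq; rewrite -(@ler_pXn2r _ 2) ?nnegrE ?mulr_ge0 ?(ltW dl0) //.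
  by apply: le_trans (pn_drop_le sF sq) _; rewrite exprMn ler_wpM2r ?sqr_ge0.
have Ldec q : L q = wrap n (f * q) + wrap n ((F - f) * q) - N q.
  by rewrite -wrapD -mulrDl (addrC f) subrK /wrap addrK.
have h1 q : (size q <= n)%N -> eta * pn n q <= pn n (L q).
  move=> sq; have A := HFf _ sq; have B := pnN _ sq.
  have D : dp * pn n q <= pn n (wrap n (f * q)).
    apply: (pn_wrap_ge n0 hz) => //; [by apply: ltW; apply: lt_trans dldp|exact: leqW|].
    by move=> j jn; case/andP: (fz _ jn).
  (* Multiplication by [f] gives [dp]; passing to [F] costs [eta], and removing the wrapped part
     costs [dl]. *)
  have -> : eta = dp - eta - dl by rewrite /eta; lra.
  have E1 : pn n (wrap n (f * q)) <= pn n (L q + N q) + pn n (wrap n ((F - f) * q)).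
    by rewrite Ldec subrK; apply: le_trans (pnB _ _ _); rewrite addrK.
  by have := pnD n (L q) (N q); lra.
have h2 q : (size q <= n)%N -> pn n (L q) <= 3 * pn n q.
  move=> sq; have A := HFf _ sq; have B := pnN _ sq.
  have D : pn n (wrap n (f * q)) <= 1 * pn n q.
    apply: (pn_wrap_le n0 hz) => //; first exact: leqW.
    by move=> j jn; case/andP: (fz _ jn).
  rewrite Ldec; apply: le_trans (pnB _ _ _) _.
  have := pnD n (wrap n (f * q)) (wrap n ((F - f) * q)).
  have eta1 : eta <= 1 by rewrite /eta; lra.
  have dl1 : dl <= 1 by lra.
  have := ler_wpM2r (pn_ge0 n q) eta1; have := ler_wpM2r (pn_ge0 n q) dl1; lra.
have h3 q : (size q <= n)%N -> wn n a (L q) <= 2 * wn n a q.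
  move=> sq; have := wnB n a (L q + rho%:C%C *: N q) (rho%:C%C *: N q); rewrite addrK wnZ.
  have := hT' _ sq; have := HN _ sq; rewrite modc_pos; last by case/andP: rho1.
  case/andP: rho1 => r0 r1; have := ler_wpM2r (wn_ge0 n a (N q)) r1.
  have := ler_wpM2r (wn_ge0 n a q) hnu; lra.
rewrite wnE -wn_dilate; set y := dilate _ p.
have sy : (size y <= n)%N by apply: leq_trans (size_dilate _ _) sp.
have := take_mul_lower_bound g0 eta0 h1 h2 h3 sy; rewrite -/K -/(L y) -/a => hy.
have : wn n a (L y) <= wn n a (L y + rho%:C%C *: N y) + nu * wn n a y.
  have := wnB n a (L y + rho%:C%C *: N y) (rho%:C%C *: N y); rewrite addrK wnZ.
  have := HN _ sy; rewrite modc_pos; last by case/andP: rho1.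
  case/andP: rho1 => r0 r1; have := ler_wpM2r (wn_ge0 n a (N y)) r1; lra.
(* Since [K * nu <= 1 / 2], the wrapped part is absorbed at the price of a factor 2. *)
rewrite -(ler_pM2l K0) mulrDr mulrA.
have := ler_wpM2r (wn_ge0 n a y) hK; lra.
Qed.

End BlockLowerBound.

(** * Lower bound on a block with a constant depending on its weights *)

Section CrudeBound.
Context {R : rcfType}.
Implicit Types (f p : {poly R[i]}) (w : nat -> R).

(** Covers the finitely many blocks too short for the uniform bound: weights between 1 and [W] allow
    a comparison with the plain norm, where Parseval applies. *)
Lemma block_crude_bound n (z : R[i]) (dp W : R) w f p :
  (0 < n)%N -> n.-primitive_root z -> 0 < dp -> (forall k, (k < n)%N -> 1 <= w k <= W) ->
  (size f <= n)%N -> (forall j, (j < n)%N -> dp <= modc f.[z ^+ j]) ->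
  (size p <= n)%N -> wn n w p <= W / dp * wn n w (wrap n (f * p)).
Proof.
move=> n0 hz dp0 hw sf fz sp.
have W0 : 0 <= W by case/andP: (hw 0%N n0) => h1 h2; apply: le_trans (le_trans ler01 h1) h2.
have h1 : pn n (wrap n (f * p)) <= wn n w (wrap n (f * p)).
  apply: ell_le => k kn; case/andP: (hw k kn) => h _.
  by rewrite modcM modc_pos ?ler_peMl // (le_trans ler01).
have h2 : wn n w p <= W * pn n p.
  rewrite -[X in X * _](modc_pos W0) /pn -ellZ; apply: ell_le => k kn.
  case/andP: (hw k kn) => h h'.
  by rewrite !modcM !modc_pos ?ler_wpM2r // (le_trans ler01).
have h3 := pn_wrap_ge n0 hz (ltW dp0) (leqW sf) sp fz.
apply: le_trans h2 _; rewrite -mulrA ler_wpM2l // ler_pdivlMl //.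
exact: le_trans h1.
Qed.

End CrudeBound.

(** * Reflection of zeros in a circle, limiting how far multiplication by [X] is bounded below *)

Section ZeroFlipping.
Context {R : realType}.
Local Notation C := R[i].
Implicit Types (f p q s t x : {poly C}).

Lemma ler_exp1D (x : R) m : 1 <= x -> 1 + m%:R * (x - 1) <= x ^+ m.
Proof.
move=> x1; elim: m => [|m IH]; first by rewrite mul0r addr0 expr0.
rewrite exprS -natr1; have := ler_wpM2l (le_trans ler01 x1) IH.
have := mulr_ge0 (ler0n R m) (sqr_ge0 (x - 1)); lra.
Qed.

Lemma modc_prod (I : Type) (r : seq I) (P : pred I) (F : I -> C) :
  modc (\prod_(i <- r | P i) F i) = \prod_(i <- r | P i) modc (F i).
Proof. exact: (big_morph _ modcM modc1). Qed.

(* Replacing the factor [X - a] by [1 - (a^* / r^2) X] preserves the difference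
   [|u|^2 - r^2 |v|^2] up to a factor that is nonnegative for [|a| <= r]. *)
Lemma flip_identity (u v a : C) (r : R) : r != 0 ->
  modc (u - a * v) ^+ 2 - r ^+ 2 * modc (v - a^* / (r ^+ 2)%:C%C * u) ^+ 2 =
  (1 - modc a ^+ 2 / r ^+ 2) * (modc u ^+ 2 - r ^+ 2 * modc v ^+ 2).
Proof.
move=> r0; rewrite -fmorphV /= !modc_sqr.
case: u v a => [u1 u2] [v1 v2] [a1 a2] /=.
by field.
Qed.

Variables (n : nat) (Rr : R) (w : nat -> R).
Hypotheses (Rr0 : 0 < Rr) (w0 : forall k, 0 <= w k).
Hypothesis wS : forall k, (k.+1 < n)%N -> Rr * w k <= w k.+1.

Lemma wn_mulX t : (size t < n)%N -> Rr * wn n w t <= wn n w ('X * t).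
Proof.
move=> st; rewrite -[X in X * _](modc_pos (ltW Rr0)) -wnZ.
apply: le_ell; case: (n) st wS => // m st hw.
rewrite big_ord_recr big_ord_recl /= coefXM mulr0 modc0 expr0n add0r.
rewrite coefZ (nth_default _ st) !mulr0 modc0 expr0n addr0.
apply: ler_sum => k _; rewrite coefXM coefZ /= mulrA !modcM !modc_pos ?(ltW Rr0) //.
by rewrite ler_pXn2r ?nnegrE ?mulr_ge0 ?(ltW Rr0) // ler_wpM2r // mulrC hw // ltnS.
Qed.

(** For [|a| > Rr] the factor [X - a] is [- a] times [1 - X / a], which gains [|a|]. Otherwise the
    zero moves to its mirror image [Rr^2 / conj a], and summing [flip_identity] over the
    coefficients reduces the claim to [wn_mulX]. *)
Lemma flip_zero t (a : C) : (size t < n)%N ->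
  exists b : C, Rr * wn n w (t * (1 - b *: 'X)) <= wn n w (t * ('X - a%:P)).
Proof.
move=> st; case: (lerP (modc a) Rr) => ha; last first.
  have a0 : a != 0 by rewrite -modc_eq0 gt_eqF // (lt_trans Rr0).
  exists a^-1; have -> : t * ('X - a%:P) = (- a) *: (t * (1 - a^-1 *: 'X)).
    rewrite scalerAr scalerBr scalerA mulNr divff // scaleN1r opprK -alg_polyC.
    by rewrite addrC scaleNr.
  by rewrite wnZ modcN ler_wpM2r // ltW.
have r0 := lt0r_neq0 Rr0.
exists (a^* / (Rr ^+ 2)%:C%C); set b := _ / _; rewrite -[X in X * _](modc_pos (ltW Rr0)) -wnZ.
apply: le_ell; rewrite -subr_ge0 -sumrB.
rewrite (eq_bigr (fun k : 'I_n => (1 - modc a ^+ 2 / Rr ^+ 2) *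
   (modc ((w k)%:C%C * ('X * t)`_k) ^+ 2 - modc ((w k)%:C%C * (Rr%:C%C *: t)`_k) ^+ 2))).
  rewrite -mulr_sumr mulr_ge0 //.
    by rewrite subr_ge0 ler_pdivrMr ?exprn_gt0 // mul1r ler_pXn2r ?nnegrE ?(ltW Rr0).
  have eS q : \sum_(k < n) modc ((w k)%:C%C * q`_k) ^+ 2 = wn n w q ^+ 2.
    by rewrite /wn ell_sqr.
  rewrite sumrB subr_ge0 !eS ler_pXn2r ?nnegrE //.
  have := wn_mulX st; rewrite -[X in X * _](modc_pos (ltW Rr0)) -wnZ; exact.
move=> k _.
have -> : (t * ('X - a%:P))`_k = ('X * t)`_k - a * t`_k.
  by rewrite mulrBr coefB coefMC (mulrC t) (mulrC a).
have -> : (Rr%:C%C *: (t * (1 - b *: 'X)))`_k = Rr%:C%C * (t`_k - b * ('X * t)`_k).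
  by rewrite coefZ mulrBr mulr1 coefB -scalerAr coefZ (mulrC t).
rewrite coefZ !modcM !modc_pos ?(ltW Rr0) // !exprMn -!mulrBr [RHS]mulrCA.
by rewrite flip_identity.
Qed.

(** The size condition keeps every intermediate product below degree [n], so that no coefficient
    escapes the norm; the normalization of [s] keeps the constant coefficient of the product under
    control. *)
Lemma flip_zeros (rs : seq C) p : (size p + size rs <= n)%N ->
  exists s, [/\ s`_0 = 1, (size s <= (size rs).+1)%N &
    Rr ^+ size rs * wn n w (p * s) <= wn n w (p * \prod_(a <- rs) ('X - a%:P))].
Proof.
elim: rs p => [|a rs IH] p /= hs.
  by exists 1; rewrite coef1 size_poly1 big_nil expr0 mul1r.
have sq : (size (p * \prod_(a <- rs) ('X - a%:P))%R < n)%N.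
  apply: leq_ltn_trans (size_polyMleq _ _) _; rewrite size_prod_XsubC addnS /=.
  by rewrite addnS in hs.
have [b hb] := flip_zero a sq.
have sX : (size (1 - b *: 'X)%R <= 2)%N.
  apply: leq_trans (size_polyD _ _) _; rewrite size_polyN size_poly1 geq_max /=.
  by apply: leq_trans (size_scale_leq _ _) _; rewrite size_polyX.
have [|s [s0 ss hs']] := IH (p * (1 - b *: 'X)).
  apply: leq_trans _ hs; rewrite addnS -addSn leq_add2r.
  by apply: leq_trans (size_polyMleq _ _) _; rewrite -subn1 leq_subLR add1n -addn2 leq_add2l.
exists ((1 - b *: 'X) * s); split.
- by rewrite coef0M s0 mulr1 coefB coef1 coefZ coefX mulr0 subr0.
- by apply: leq_trans (size_polyMleq _ _) _; rewrite -subn1 leq_subLR add1n (leq_add sX ss).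
rewrite big_cons exprS -mulrA (mulrC ('X - _)) [X in _ <= wn n w X]mulrA; apply: le_trans hb.
by rewrite ler_wpM2l ?(ltW Rr0) // mulrA [X in _ <= wn n w X]mulrAC.
Qed.

Variables (z : C) (J : {set 'I_n}).
Hypotheses (hz : n.-primitive_root z) (n0 : (0 < n)%N) (w1 : 0 < w n.-1).

(** The span of the idempotents with index in [J], described by zeros so that its elements can be
    factored. *)
Definition vanish_off p := (size p <= n)%N /\ forall i : 'I_n, i \notin J -> p.[z ^+ i] = 0.

(* Flipping the free zeros of [x] and dividing by ['X] modulo ['X^n - 1] yields a
   polynomial with the same vanishing conditions and a leading coefficient of the
   same modulus. *)
Lemma vanish_off_flip x : vanish_off x -> modc x`_n.-1 = 1 ->
  exists y, [/\ vanish_off y, modc y`_n.-1 = 1 &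
    Rr ^+ #|J|.-1 * wn n w (wrap n ('X * y)) <= wn n w x].
Proof.
move=> [sx vx] lx.
have szx : size x = n.
  apply/eqP; rewrite eqn_leq sx -[X in (X <= _)%N](prednK n0) ltnNge.
  apply/negP => h; move: lx; rewrite nth_default // modc0 => /esym/eqP.
  by rewrite oner_eq0.
(* The forced zeros; the cofactor [s] of their product has degree [#|J|.-1], and its roots are the
   free zeros. *)
pose rJ := [seq z ^+ (i : 'I_n) | i <- enum (~: J)].
have urJ : uniq_roots rJ.
  rewrite uniq_rootsE map_inj_uniq ?enum_uniq // => i j /eqP.
  by rewrite (eq_prim_root_expr hz) !modn_small // => /eqP/val_inj.
have [|s xE] := @uniq_roots_prod_XsubC _ x rJ _ urJ.
  apply/allP => _ /mapP[k kJ ->]; apply/rootP/vx.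
  by move: kJ; rewrite mem_enum inE.
set pJ := \prod_(a <- rJ) _ in xE.
have szrJ : (size rJ + #|J| = n)%N.
  by rewrite size_map -cardE addnC cardsC card_ord.
have mJ : pJ \is monic by rewrite monic_prod_XsubC.
have s0 : s != 0.
  by apply: contra_eq_neq szx => s0; rewrite xE s0 mul0r size_poly0 eq_sym -lt0n.
have szs : size s = #|J|.
  move: szx; rewrite xE size_Mmonic // size_prod_XsubC addnS /= -[in RHS]szrJ addnC.
  by move=> /addnI.
have ls : modc (lead_coef s) = 1.
  by rewrite -lx -szx -lead_coefE xE lead_coef_Mmonic.
have [rs sE] := closed_field_poly_normal s.
have szrs : size rs = #|J|.-1.
  by rewrite -szs sE size_scale ?lead_coef_eq0 // size_prod_XsubC.
have szpJ : (size (lead_coef s *: pJ) = (size rJ).+1)%N.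
  by rewrite size_scale ?lead_coef_eq0 // size_prod_XsubC.
have J0 : (0 < #|J|)%N by rewrite -szs lt0n size_poly_eq0.
have [|t [t0 st ht]] := @flip_zeros rs (lead_coef s *: pJ).
  by rewrite szpJ szrs addSn -addnS prednK // szrJ.
set q := lead_coef s *: pJ * t in ht.
have sq : (size q <= n)%N.
  apply: leq_trans (size_polyMleq _ _) _; rewrite szpJ addSn /= -szrJ leq_add2l.
  by rewrite -(prednK J0) -szrs.
have q0 : modc q`_0 = 1.
  rewrite coef0M t0 mulr1 coefZ modcM ls mul1r -horner_coef0 horner_prod modc_prod.
  rewrite big_map big1 // => i _.
  by rewrite hornerXsubC sub0r modcN (modc_prim_exp n0 hz).
have qJ (i : 'I_n) : i \notin J -> q.[z ^+ i] = 0.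
  move=> iJ; apply/rootP; rewrite /q rootM; apply/orP; left; apply/rootP; rewrite hornerZ.
  suff /rootP -> : root pJ (z ^+ i) by rewrite mulr0.
  rewrite root_prod_XsubC; apply/mapP; exists i => //; by rewrite mem_enum inE.
have sXq : (size ('X^(n.-1) * q)%R <= n + n)%N.
  apply: leq_trans (size_polyMleq _ _) _; rewrite size_polyXn prednK //.
  by rewrite (leq_trans (leq_pred _)) // leq_add2l.
have sy := size_wrap sXq.
(* Modulo [X^n - 1] this is [q / X]: the constant coefficient of [q], of modulus 1 because the
   forced zeros lie on the unit circle, becomes the coefficient of degree [n.-1]. *)
exists (wrap n ('X^(n.-1) * q)); split.
- split=> // i iJ; rewrite wrap_horner ?(prim_exp_order hz) //.
  by rewrite hornerM qJ // mulr0.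
- rewrite /wrap coefD coef_take_poly coef_drop_poly prednK // leqnn !coefXnM ltnn subnn.
  by rewrite ltnNge leq_addr /= addKn [q`_n]nth_default // addr0.
rewrite (_ : wrap n _ = q); last first.
  apply: (horner_inj n0 hz) => // [|j jn].
    apply: size_wrapM => //; by rewrite size_polyX.
  rewrite wrap_horner ?(prim_exp_order hz) // hornerM hornerX.
  rewrite wrap_horner ?(prim_exp_order hz) // hornerM hornerXn mulrA -exprS prednK //.
  by rewrite (prim_exp_order hz) mul1r.
rewrite -szrs; apply: le_trans ht _.
by rewrite xE [in leRHS]sE -!scalerAl (mulrC pJ).
Qed.

(* Iterating the previous lemma would drive to [0] the norm of polynomials whose
   coefficient of degree [n.-1] has modulus [1]. *)
Lemma vanish_off_lower_bound (kap : R) : (0 < #|J|)%N -> 0 <= kap ->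
  (forall p, vanish_off p -> kap * wn n w p <= wn n w (wrap n ('X * p))) ->
  kap * Rr ^+ #|J|.-1 <= 1.
Proof.
move=> J0 kap0 hk; rewrite leNgt; apply/negP => h; set rho := kap * _ in h.
pose pJ := \prod_(a <- [seq z ^+ (i : 'I_n) | i <- enum (~: J)]) ('X - a%:P).
have szp : size (pJ * 'X^(#|J|.-1)) = n.
  rewrite size_Mmonic ?monicXn ?monic_neq0 ?monic_prod_XsubC // size_prod_XsubC size_polyXn.
  by rewrite prednK // size_map -cardE addSn /= addnC cardsC card_ord.
(* Seed of the iteration: the forced zeros, completed by zeros at the origin to reach size exactly
   [n]. *)
have [x0 [vx0 lx0]] : exists x, vanish_off x /\ modc x`_n.-1 = 1.
  exists (pJ * 'X^(#|J|.-1)); split; last first.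
    rewrite -[in X in _`_X]szp -lead_coefE lead_coefM lead_coefXn mulr1.
    by rewrite (monicP _) ?monic_prod_XsubC // modc1.
  split=> [|i iJ]; first by rewrite szp.
  rewrite hornerM; suff /rootP -> : root pJ (z ^+ i) by rewrite mul0r.
  by rewrite root_prod_XsubC; apply/mapP; exists i => //; rewrite mem_enum inE.
have it m : exists x, [/\ vanish_off x, modc x`_n.-1 = 1 & rho ^+ m * wn n w x <= wn n w x0].
  elim: m => [|m [x [vx lx hx]]]; first by exists x0; rewrite expr0 mul1r.
  have [y [vy ly hy]] := vanish_off_flip vx lx; exists y; split=> //.
  apply: le_trans hx; rewrite exprSr -mulrA ler_wpM2l ?exprn_ge0 ?(le_trans ler01 (ltW h)) //.
  apply: le_trans hy; rewrite /rho mulrAC mulrC ler_wpM2l ?exprn_ge0 ?(ltW Rr0) //.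
  exact: hk.
(* The powers of [rho] grow at least linearly, while the coefficient of degree [n.-1] keeps the norm
   above [w n.-1]. *)
have lbd m : 1 + m%:R * (rho - 1) <= wn n w x0 / w n.-1.
  have [x [vx lx hx]] := it m; rewrite ler_pdivlMr //.
  have h1 : w n.-1 <= wn n w x.
    have nn : (n.-1 < n)%N by rewrite ltn_predL.
    have := modc_le_ell (fun k => (w k)%:C%C * x`_k) nn.
    by rewrite /= modcM modc_pos // lx mulr1.
  apply: le_trans hx; apply: ler_pM => //; [|].
    by rewrite addr_ge0 // mulr_ge0 // subr_ge0 ltW.
  exact/ler_exp1D/ltW.
have := lbd (Num.bound (wn n w x0 / w n.-1 / (rho - 1))).
have r1 : 0 < rho - 1 by rewrite subr_gt0.
have := archi_boundP (_ : 0 <= wn n w x0 / w n.-1 / (rho - 1)).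
rewrite !divr_ge0 ?(ltW r1) ?(ltW w1) // => /(_ isT); rewrite ltr_pdivrMr //.
lra.
Qed.

End ZeroFlipping.

(** * The normed space of square summable complex sequences *)

Section SquareSummable.
Context {R : realType}.
Local Notation C := R[i].

Definition square_summable (x : nat -> C) := exists M : R, forall n, ell n x <= M.

Definition l2pred : {pred nat -> C} := [pred x | `[<square_summable x>]].

Record l2 := L2 { l2val :> nat -> C; l2valP : l2val \in l2pred }.

HB.instance Definition _ := [isSub for l2val].
HB.instance Definition _ := [Choice of l2 by <:].

Lemma l2predP (x : nat -> C) : reflect (square_summable x) (x \in l2pred).
Proof. exact: asboolP. Qed.

Lemma square_summableB (x y : nat -> C) :
  square_summable x -> square_summable y -> square_summable (fun k => x k - y k).
Proof.
move=> [M hM] [N hN]; exists (M + N) => n.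
by apply: le_trans (ellB _ _ _) _; apply: lerD.
Qed.

Lemma square_summableZ (c : C) (x : nat -> C) :
  square_summable x -> square_summable (fun k => c * x k).
Proof. by move=> [M hM]; exists (modc c * M) => n; rewrite ellZ ler_wpM2l. Qed.

Lemma l2pred_zmod_closed : zmod_closed l2pred.
Proof.
split=> [|x y /l2predP hx /l2predP hy]; last exact/l2predP/square_summableB.
apply/l2predP; exists 0 => n; rewrite /ell big1 ?sqrtr0 // => k _.
by rewrite modc0 expr0n.
Qed.
HB.instance Definition _ := GRing.isZmodClosed.Build (nat -> C) l2pred l2pred_zmod_closed.
HB.instance Definition _ := [SubChoice_isSubZmodule of l2 by <:].

Implicit Types (x y : l2) (c : C).

Lemma l2P x y : (forall k, x k = y k) -> x = y.
Proof. by move=> h; apply/val_inj/funext. Qed.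

Lemma l2D x y k : (x + y) k = x k + y k.
Proof. by []. Qed.

Lemma l2B x y k : (x - y) k = x k - y k.
Proof. by []. Qed.

Lemma l20 k : (0 : l2) k = 0.
Proof. by []. Qed.

Fact l2scale_subproof c x : (fun k => c * x k) \in l2pred.
Proof. exact/l2predP/square_summableZ/l2predP/(l2valP x). Qed.
Definition l2scale c x := L2 (l2scale_subproof c x).

Fact l2scaleA c d x : l2scale c (l2scale d x) = l2scale (c * d) x.
Proof. by apply: l2P => k; rewrite /= mulrA. Qed.
Fact l2scale1 : left_id 1 l2scale.
Proof. by move=> x; apply: l2P => k; rewrite /= mul1r. Qed.
Fact l2scaleDr : right_distributive l2scale +%R.
Proof. by move=> c x y; apply: l2P => k; rewrite /= mulrDr. Qed.
Fact l2scaleDl x : {morph l2scale^~ x : c d / c + d}.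
Proof. by move=> c d; apply: l2P => k; rewrite /= mulrDl. Qed.
HB.instance Definition _ := GRing.Zmodule_isLmodule.Build C l2
  l2scaleA l2scale1 l2scaleDr l2scaleDl.

Lemma l2Z c x k : (c *: x) k = c * x k.
Proof. by []. Qed.

Lemma l2_sum (I : Type) (r : seq I) (P : pred I) (F : I -> l2) k :
  (\sum_(i <- r | P i) F i) k = \sum_(i <- r | P i) F i k.
Proof. by elim/big_rec2: _ => // i y1 y2 _ <-. Qed.

Definition l2norm x : R := sup (range (ell ^~ x)).

Lemma has_sup_ell x : has_sup (range (ell ^~ x)).
Proof.
split; first by exists (ell 0 x), 0%N.
by have /l2predP[M hM] := l2valP x; exists M => _ [n _ <-].
Qed.

Lemma ell_le_l2norm n x : ell n x <= l2norm x.
Proof. by apply: (sup_upper_bound (has_sup_ell x)); exists n. Qed.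

Lemma l2norm_le x (M : R) : (forall n, ell n x <= M) -> l2norm x <= M.
Proof. by move=> h; apply: ge_sup; [exists (ell 0 x), 0%N|move=> _ [n _ <-]]. Qed.

Lemma l2norm_ge0 x : 0 <= l2norm x.
Proof. exact: le_trans (ell_le_l2norm 0 x). Qed.

Lemma modc_le_l2norm x k : modc (x k) <= l2norm x.
Proof. exact: le_trans (modc_le_ell _ (ltnSn k)) (ell_le_l2norm _ _). Qed.

Lemma l2normD x y : l2norm (x + y) <= l2norm x + l2norm y.
Proof.
by apply: l2norm_le => n; apply: le_trans (ellD _ _ _) _; apply: lerD; apply: ell_le_l2norm.
Qed.

Lemma l2normZ c x : l2norm (c *: x) = modc c * l2norm x.
Proof.
apply/eqP; rewrite eq_le; apply/andP; split.
  by apply: l2norm_le => n; rewrite ellZ ler_wpM2l // ell_le_l2norm.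
have [->|c0] := eqVneq c 0; first by rewrite modc0 mul0r l2norm_ge0.
have mc0 : 0 < modc c by rewrite lt_def modc_eq0 c0 modc_ge0.
rewrite -ler_pdivlMl //; apply: l2norm_le => n.
by rewrite ler_pdivlMl // -ellZ; apply: (ell_le_l2norm n (c *: x)).
Qed.

Lemma l2norm_eq0 x : l2norm x = 0 -> x = 0.
Proof.
move=> h; apply: l2P => k; rewrite l20; apply/eqP; rewrite -modc_eq0 eq_le modc_ge0 andbT.
by rewrite -h modc_le_l2norm.
Qed.

Fact l2_ler_normD x y : (l2norm (x + y))%:C%C <= (l2norm x)%:C%C + (l2norm y)%:C%C :> C.
Proof. by rewrite -rmorphD lecR l2normD. Qed.
Fact l2_normrZ c x : (l2norm (c *: x))%:C%C = `|c| * (l2norm x)%:C%C :> C.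
Proof. by rewrite l2normZ rmorphM /= modcE. Qed.
Fact l2_normr0_eq0 x : (l2norm x)%:C%C = 0 :> C -> x = 0.
Proof. by move=> /complexI; exact: l2norm_eq0. Qed.
HB.instance Definition _ := @Lmodule_isNormed.Build C l2 (fun x => (l2norm x)%:C%C)
  l2_ler_normD l2_normrZ l2_normr0_eq0.

Lemma l2_normE x : `|x| = (l2norm x)%:C%C.
Proof. by []. Qed.

End SquareSummable.
Arguments l2 R : clear implicits.

(** * Completeness of [l2] *)

Section Completeness.
Context {R : realType}.
Local Notation C := R[i].
Implicit Types (x y z : l2 R) (c : C).

(** Positivity in [R[i]] forces a zero imaginary part, so every epsilon may be taken real. *)
Lemma gt0_complexP c : 0 < c -> exists2 e : R, 0 < e & c = e%:C%C.
Proof.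
case: c => a b; rewrite ltcE /= => /andP[/eqP -> a0]; by exists a.
Qed.

Lemma modc_le_Re_Im c : modc c <= `|complex.Re c| + `|complex.Im c|.
Proof.
rewrite [in leLHS](complexE c); apply: le_trans (modcD _ _) _.
rewrite modcM !modc_real lerD2l ler_piMl // modc_sqrt /=.
by rewrite expr0n add0r expr1n sqrtr1.
Qed.

Lemma Re_le_modc c : `|complex.Re c| <= modc c.
Proof. by rewrite -lecR -modcE normc_ge_Re. Qed.

Lemma Im_le_modc c : `|complex.Im c| <= modc c.
Proof.
have := Re_le_modc (c * 'i%C); rewrite ReiNIm normrN modcM => h; apply: le_trans h _.
by rewrite [modc 'i%C]modc_sqrt /= expr0n add0r expr1n sqrtr1 mulr1.
Qed.

Lemma l2_cvgP {T : Type} {F : set_system T} {FF : Filter F} (f : T -> l2 R) z :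
  f @ F --> z <-> forall e : R, 0 < e -> \forall t \near F, l2norm (z - f t) < e.
Proof.
split=> [/cvgrPdist_lt h e e0|h].
  have := h e%:C%C; rewrite ltcR => /(_ e0); apply: filterS => t.
  by rewrite l2_normE ltcR.
apply/cvgrPdist_lt => _ /gt0_complexP[e e0 ->]; have := h e e0; apply: filterS => t.
by rewrite l2_normE ltcR.
Qed.

(** The limit is built coordinatewise from real and imaginary parts; distances to it are estimated
    on finite segments, uniformly in their length. *)
Lemma l2_complete (F : set_system (l2 R)) : ProperFilter F -> cauchy F -> cvg F.
Proof.
move=> FF /cauchyP cF.
have H (e : R) : 0 < e -> exists y, F [set u | l2norm (y - u) < e].
  move=> e0; have [|y hy] := cF e%:C%C; first by rewrite ltcR.
  by exists y; move: hy; rewrite -ball_normE; apply: filterS => u; rewrite /= l2_normE ltcR.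
have cvg_coord (phi : C -> R) k : (forall a b, phi (a - b) = phi a - phi b) ->
    (forall a, `|phi a| <= modc a) -> cvg ((fun u : l2 R => phi (u k)) @ F).
  move=> phiB phi1; apply/cauchy_cvgP/cauchyP => e e0; have [y hy] := H e e0.
  exists (phi (y k)); change (F [set u : l2 R | ball (phi (y k)) e (phi (u k))]).
  apply: filterS hy => u /= hu; rewrite -ball_normE /=.
  rewrite -phiB; apply: le_lt_trans hu; apply: le_trans (phi1 _) _.
  exact: (modc_le_l2norm (y - u) k).
have cvgRe k : cvg ((fun u : l2 R => complex.Re (u k)) @ F).
  by apply: cvg_coord => [[a b] [c d]|a] //; apply: Re_le_modc.
have cvgIm k : cvg ((fun u : l2 R => complex.Im (u k)) @ F).
  by apply: cvg_coord => [[a b] [c d]|a] //; apply: Im_le_modc.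
pose z k : C := Complex (lim ((fun u : l2 R => complex.Re (u k)) @ F))
                    (lim ((fun u : l2 R => complex.Im (u k)) @ F)).
have H1 k (e : R) : 0 < e -> \forall u \near F, modc ((u : l2 R) k - z k) < e.
  move=> e0; have e2 : 0 < e / 2 by rewrite divr_gt0.
  have /cvgrPdistC_lt/(_ _ e2) h1 := cvgRe k; have /cvgrPdistC_lt/(_ _ e2) h2 := cvgIm k.
  apply: filterS2 h1 h2 => u; rewrite /z.
  case: (u k) => a b /= h1 h2; apply: le_lt_trans (modc_le_Re_Im _) _ => /=; lra.
have H2 n (e : R) : 0 < e -> \forall u \near F, forall k, (k < n)%N -> modc ((u : l2 R) k - z k) < e.
  move=> e0; elim: n => [|n IH]; first by near=> u.
  apply: filterS2 IH (H1 n e e0) => u h1 h2 k; rewrite ltnS leq_eqVlt => /orP[/eqP ->//|].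
  exact: h1.
have H3 n y (e : R) : 0 < e -> F [set u | l2norm (y - u) < e] ->
    ell n (fun k => y k - z k) <= e.
  move=> e0 hy; apply/ler_addgt0Pr => d d0.
  have s0 : 0 < Num.sqrt n%:R + 1 :> R by rewrite ltr_wpDl ?sqrtr_ge0.
  have [u [h1 h2]] := filter_ex (filterI hy (H2 n (d / (Num.sqrt n%:R + 1)) (divr_gt0 d0 s0))).
  rewrite (@eq_ell _ _ _ (fun k => (y - u) k + (u k - z k))); last first.
    by move=> k _; rewrite l2B addrA subrK.
  apply: le_trans (ellD _ _ _) _; apply: lerD.
    exact: le_trans (ell_le_l2norm _ _) (ltW h1).
  apply: le_trans (ell_bound (M := d / (Num.sqrt n%:R + 1)) _ _) _.
  - by rewrite divr_ge0 // ltW.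
  - by move=> k kn; apply/ltW/h2.
  rewrite mulrA ler_pdivrMr // mulrC ler_pM2l //; lra.
have [y1 hy1] := H 1 ltr01.
have zP : z \in l2pred.
  apply/l2predP; exists (l2norm y1 + 1) => n.
  rewrite (@eq_ell _ _ _ (fun k => y1 k - (y1 k - z k))); last by move=> k _; rewrite subKr.
  by apply: le_trans (ellB _ _ _) _; apply: lerD; [apply: ell_le_l2norm|apply: H3].
apply/cvg_ex; exists (L2 zP); apply/(@l2_cvgP _ F _ id) => e e0.
have e3 : 0 < e / 3 by rewrite divr_gt0.
have [y hy] := H _ e3.
have h3 : l2norm (y - L2 zP) <= e / 3 by apply: l2norm_le => n; apply: H3.
apply: filterS hy => u hu.
have -> : L2 zP - u = (y - u) - (y - L2 zP) by rewrite opprB [RHS]addrC addrA subrK.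
have := l2normD (y - u) (- (y - L2 zP)).
have -> : l2norm (- (y - L2 zP)) = l2norm (y - L2 zP).
  by rewrite -scaleN1r l2normZ modcN modc1 mul1r.
move: (l2norm _) (l2norm _) hu h3 => a b /= hu h3; lra.
Unshelve. all: by end_near. Qed.

HB.instance Definition _ := Uniform_isComplete.Build (l2 R) l2_complete.

End Completeness.

(** * The inner product of [l2] *)

Section InnerProduct.
Context {R : realType}.
Local Notation C := R[i].
Implicit Types (x y z : l2 R) (c : C).

Definition psum n (x y : nat -> C) : C := \sum_(k < n) x k * (y k)^*.

Definition l2inner x y : C := lim ((fun n => psum n x y : C^o) @ \oo).

Lemma ell_cvg x : (ell ^~ x) @ \oo --> l2norm x.
Proof.
apply: nondecreasing_cvgn; last by have [] := has_sup_ell x.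
by move=> m n mn; apply: ell_widen.
Qed.

Lemma complex_cvg (u : nat -> C^o) (a b : R) :
  (fun n => complex.Re (u n)) @ \oo --> a -> (fun n => complex.Im (u n)) @ \oo --> b ->
  u @ \oo --> ((a +i* b)%C : C^o).
Proof.
move=> /cvgrPdist_lt ha /cvgrPdist_lt hb; apply/cvgrPdist_lt => _ /gt0_complexP[e e0 ->].
have e2 : 0 < e / 2 by rewrite divr_gt0.
apply: filterS2 (ha _ e2) (hb _ e2) => n h1 h2; rewrite modcE ltcR.
apply: le_lt_trans (modc_le_Re_Im _) _; move: h1 h2; case: (u n) => p q /=; lra.
Qed.

Lemma Re_sum (I : Type) (r : seq I) (F : I -> C) :
  complex.Re (\sum_(i <- r) F i) = \sum_(i <- r) complex.Re (F i).
Proof. exact: (raddf_sum (@complex.Re R)). Qed.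

Lemma Im_sum (I : Type) (r : seq I) (F : I -> C) :
  complex.Im (\sum_(i <- r) F i) = \sum_(i <- r) complex.Im (F i).
Proof. exact: (raddf_sum (@complex.Im R)). Qed.

(** Polarization: real parts of partial inner products converge because three norms do, and
    replacing [d] by [i d] settles the imaginary parts. *)
Lemma Re_mul_conj (c d : C) :
  complex.Re (c * d^*) = (modc (c + d) ^+ 2 - modc c ^+ 2 - modc d ^+ 2) / 2.
Proof. rewrite !modc_sqr; case: c d => [a b] [p q] /=; by field. Qed.

Lemma Im_mul_conj (c d : C) : complex.Im (c * d^*) = complex.Re (c * ('i%C * d)^*).
Proof. by case: c d => [a b] [p q] /=; ring. Qed.

Lemma Re_psum_cvg x y : cvg ((fun n => complex.Re (psum n x y)) @ \oo).
Proof.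
have -> : (fun n => complex.Re (psum n x y)) =
    (fun n => (ell n (x + y) ^+ 2 - ell n x ^+ 2 - ell n y ^+ 2) / 2).
  apply/funext => n; rewrite /psum Re_sum !ell_sqr -!sumrB mulr_suml.
  by apply: eq_bigr => k _; rewrite Re_mul_conj.
have h z : cvg ((fun n => ell n z ^+ 2) @ \oo).
  by apply/cvg_ex; exists (l2norm z ^+ 2); apply: cvgM; apply: ell_cvg.
by apply: is_cvgMr_tmp; apply: is_cvgB; [apply: is_cvgB|]; apply: h.
Qed.

Lemma psum_cvg x y : (fun n => psum n x y : C^o) @ \oo --> (l2inner x y : C^o).
Proof.
have h1 := @Re_psum_cvg x y; have h2 := @Re_psum_cvg x ('i%C *: y).
have E : (fun n => complex.Im (psum n x y)) = (fun n => complex.Re (psum n x ('i%C *: y))).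
  apply/funext => n; rewrite /psum Re_sum Im_sum.
  by apply: eq_bigr => k _; rewrite Im_mul_conj.
apply/cvg_ex; rewrite -E in h2.
exists (lim ((fun n => complex.Re (psum n x y)) @ \oo) +i*
        lim ((fun n => complex.Im (psum n x y)) @ \oo))%C.
exact: complex_cvg.
Qed.

Lemma l2innerE x y (c : C^o) : (fun n => psum n x y : C^o) @ \oo --> c -> l2inner x y = c.
Proof. by move=> h; apply: cvg_lim h; apply: norm_hausdorff. Qed.

Lemma l2inner_zmodl y : zmod_morphism (l2inner ^~ y).
Proof.
move=> x z; apply: l2innerE.
have -> : (fun n => psum n (x - z) y) = (fun n => psum n x y : C^o) - (fun n => psum n z y : C^o).
  apply/funext => n; rewrite -[RHS]/(psum n x y - psum n z y) /psum -sumrB; apply: eq_bigr => k _.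
  by rewrite l2B mulrBl.
by apply: cvgB; apply: psum_cvg.
Qed.

Lemma l2inner_herm x y : l2inner x y = (-1) ^+ false * Num.conj (l2inner y x).
Proof.
rewrite expr0 mul1r; apply: l2innerE.
have /cvgrPdist_lt h := @psum_cvg y x; apply/cvgrPdist_lt => e e0.
apply: filterS (h e e0) => n; rewrite -norm_conjC rmorphB /=.
rewrite /psum rmorph_sum /=; congr (`|_ - _| < e); apply: eq_bigr => k _.
by rewrite rmorphM /= conjCK mulrC.
Qed.

Lemma l2inner_scalel y : scalable_for *%R (l2inner ^~ y).
Proof.
move=> c x; apply: l2innerE.
have -> : (fun n => psum n (c *: x) y) = (fun n => c * psum n x y).
  by apply/funext => n; rewrite /psum mulr_sumr; apply: eq_bigr => k _; rewrite l2Z mulrA.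
by apply: cvgMr; apply: psum_cvg.
Qed.

Lemma l2inner_zmodr x : zmod_morphism (l2inner x).
Proof.
move=> y z; rewrite !(l2inner_herm x) !expr0 !mul1r.
by rewrite l2inner_zmodl rmorphB.
Qed.

Lemma l2inner_scaler x : scalable_for (Num.conj \; *%R) (l2inner x).
Proof.
move=> c y; rewrite !(l2inner_herm x) !expr0 !mul1r.
by rewrite l2inner_scalel rmorphM.
Qed.

Lemma l2inner_norm x : l2inner x x = `|x| ^+ 2.
Proof.
apply: l2innerE; rewrite l2_normE -rmorphXn.
have -> : (fun n => psum n x x) = (fun n => (ell n x ^+ 2)%:C%C).
  apply/funext => n; rewrite ell_sqr rmorph_sum; apply: eq_bigr => k _.
  by rewrite -modc_mul_conj.
apply: complex_cvg => /=; last exact: cvg_cst.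
by apply: cvgM; apply: ell_cvg.
Qed.

Lemma l2inner_gt0 x : x != 0 -> 0 < l2inner x x.
Proof. by move=> x0; rewrite l2inner_norm exprn_gt0 // normr_gt0. Qed.

HB.instance Definition _ := isBilinear.Build C (l2 R) (l2 R) C *%R (Num.conj \; *%R) l2inner
  l2inner_zmodl l2inner_zmodr l2inner_scalel l2inner_scaler.
HB.instance Definition _ := isHermitianSesquilinear.Build C (l2 R) false Num.conj l2inner
  l2inner_herm.
HB.instance Definition _ := isDotProduct.Build C (l2 R) l2inner l2inner_gt0.

Definition l2hilbert : hilbertSpace R :=
  @HilbertSpace R (l2 R) l2inner l2inner_norm.

Lemma l2inner_disjoint x y : (forall k, x k = 0 \/ y k = 0) -> l2inner x y = 0.
Proof.
move=> h; apply: l2innerE; have -> : (fun n => psum n x y) = fun=> 0.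
  by apply/funext => n; rewrite /psum big1 // => k _; case: (h k) => ->; rewrite ?mul0r ?rmorph0 ?mulr0.
exact: cvg_cst.
Qed.

End InnerProduct.

(** * Partition of the natural numbers into consecutive blocks of prescribed lengths *)

Section BlockIndices.
Variable (bsz : nat -> nat).
Hypothesis bsz_gt0 : forall s, (0 < bsz s)%N.

Definition boff s := (\sum_(t < s) bsz t)%N.

Lemma boffS s : boff s.+1 = (boff s + bsz s)%N.
Proof. by rewrite /boff big_ord_recr. Qed.

Lemma boff_mono s t : (s <= t)%N -> (boff s <= boff t)%N.
Proof.
elim: t => [|t IH]; first by rewrite leqn0 => /eqP ->.
rewrite leq_eqVlt => /orP[/eqP ->//|]; rewrite ltnS => /IH h.
by rewrite boffS (leq_trans h) // leq_addr.
Qed.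

Lemma leq_boff s : (s <= boff s)%N.
Proof. by elim: s => // s IH; rewrite boffS -addn1 leq_add. Qed.

Lemma ex_blk j : exists s, (j < boff s.+1)%N.
Proof. by exists j; apply: leq_boff. Qed.

Definition blk j := ex_minn (ex_blk j).

Definition pos j := (j - boff (blk j))%N.

Lemma blkP j : (boff (blk j) <= j < boff (blk j).+1)%N.
Proof.
rewrite /blk; case: ex_minnP => s hs smin; rewrite hs andbT.
case: s hs smin => [|s] hs smin; first by rewrite /boff big_ord0.
by rewrite leqNgt; apply/negP => /smin; rewrite ltnn.
Qed.

Lemma blk_eq s j : (boff s <= j < boff s.+1)%N -> blk j = s.
Proof.
move=> /andP[h1 h2]; have /andP[h3 h4] := blkP j; case: (ltngtP (blk j) s) => // /boff_mono h.
  by have := leq_trans h4 (leq_trans h h1); rewrite ltnn.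
by have := leq_trans h2 (leq_trans h h3); rewrite ltnn.
Qed.

Lemma blk_boff s i : (i < bsz s)%N -> blk (boff s + i) = s.
Proof. by move=> hi; apply: blk_eq; rewrite leq_addr boffS ltn_add2l. Qed.

Lemma pos_boff s i : (i < bsz s)%N -> pos (boff s + i) = i.
Proof. by move=> hi; rewrite /pos blk_boff // addKn. Qed.

Lemma boff_pos j : (boff (blk j) + pos j)%N = j.
Proof. by rewrite subnKC //; case/andP: (blkP j). Qed.

Lemma pos_lt j : (pos j < bsz (blk j))%N.
Proof. by rewrite -(ltn_add2l (boff (blk j))) boff_pos -boffS; case/andP: (blkP j). Qed.

Lemma boff_blk_le j : (boff (blk j) <= j)%N.
Proof. by case/andP: (blkP j). Qed.

Lemma leq_blk K j : (boff K <= j)%N -> (K <= blk j)%N.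
Proof.
move=> h; rewrite leqNgt; apply/negP => /boff_mono h'; case/andP: (blkP j) => _ h2.
by have := leq_trans h2 (leq_trans h' h); rewrite ltnn.
Qed.

Lemma sum_boff (V : nmodType) m (F : nat -> V) :
  \sum_(j < boff m) F j = \sum_(s < m) \sum_(i < bsz s) F (boff s + i)%N.
Proof.
elim: m => [|m IH]; first by rewrite /boff !big_ord0.
rewrite [RHS]big_ord_recr /= -IH -(big_mkord xpredT) -(big_mkord xpredT F).
rewrite boffS (big_cat_nat (n := boff m)) //= ?leq_addr //; congr (_ + _).
rewrite -[X in \sum_(X <= _ < _) _]add0n big_addn addKn big_mkord.
by apply: eq_bigr => i _; rewrite addnC.
Qed.

End BlockIndices.

(** * Sequences as families of polynomials, one for each block *)

Section BlockVectors.
Context {R : realType}.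
Local Notation C := R[i].
Variables (bsz : nat -> nat) (w : nat -> nat -> R).
Hypotheses (bsz_gt0 : forall s, (0 < bsz s)%N) (w_gt0 : forall s k, 0 < w s k).
Local Notation N := (boff bsz).
Local Notation blk := (blk bsz_gt0).
Local Notation pos := (pos bsz_gt0).
Local Notation bnorm s := (wn (bsz s) (w s)).
Implicit Types (x y : l2 R) (p q : {poly C}) (c : C).

Lemma wc_neq0 s k : (w s k)%:C%C != 0.
Proof. by rewrite -modc_eq0 modc_pos ?gt_eqF // ltW. Qed.

(* The coordinates [boff bsz s <= j < boff bsz s.+1] of a sequence encode a polynomial
   [p] of size at most [bsz s]: the coordinate [boff bsz s + k] is [w s k * p`_k]. *)
Definition bpoly s (x : nat -> C) : {poly C} :=
  \poly_(k < bsz s) (x (N s + k)%N / (w s k)%:C%C).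

Lemma size_bpoly s (x : nat -> C) : (size (bpoly s x) <= bsz s)%N.
Proof. exact: size_poly. Qed.

Lemma coef_bpoly s (x : nat -> C) k : (k < bsz s)%N -> (w s k)%:C%C * (bpoly s x)`_k = x (N s + k)%N.
Proof. by move=> ks; rewrite coef_poly ks mulrC divfK ?wc_neq0. Qed.

Lemma bpolyB s x y : bpoly s (x - y) = bpoly s x - bpoly s y.
Proof.
by apply/polyP => k; rewrite coefB !coef_poly; case: ifP; rewrite ?subr0 // l2B mulrBl.
Qed.

Lemma bpolyD s x y : bpoly s (x + y) = bpoly s x + bpoly s y.
Proof.
by apply/polyP => k; rewrite coefD !coef_poly; case: ifP; rewrite ?addr0 // l2D mulrDl.
Qed.

Lemma bpolyZ s c x : bpoly s (c *: x) = c *: bpoly s x.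
Proof.
by apply/polyP => k; rewrite coefZ !coef_poly; case: ifP; rewrite ?mulr0 // l2Z mulrA.
Qed.

Lemma bpoly_inj x y : (forall s, bpoly s x = bpoly s y) -> x = y.
Proof.
move=> h; apply: l2P => j; rewrite -(boff_pos bsz_gt0 j).
by rewrite -!coef_bpoly ?pos_lt // h.
Qed.

Lemma bnormE s (x : nat -> C) : bnorm s (bpoly s x) = ell (bsz s) (fun k => x (N s + k)%N).
Proof. by apply: eq_ell => k ks; rewrite coef_bpoly. Qed.

Lemma ell_boff m (x : nat -> C) : ell (N m) x ^+ 2 = \sum_(s < m) bnorm s (bpoly s x) ^+ 2.
Proof.
rewrite ell_sqr (sum_boff bsz m (fun j => modc (x j) ^+ 2)).
by apply: eq_bigr => s _; rewrite bnormE ell_sqr.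
Qed.

Lemma l2norm_le_blocks x (M : R) : 0 <= M ->
  (forall m, \sum_(s < m) bnorm s (bpoly s x) ^+ 2 <= M ^+ 2) -> l2norm x <= M.
Proof.
move=> M0 h; apply: l2norm_le => n; apply: le_trans (ell_widen _ (leq_boff bsz_gt0 n)) _.
by rewrite -(@ler_pXn2r _ 2) ?nnegrE // ell_boff.
Qed.

(** Converse encoding to [bpoly], supported on the block [s]. *)
Definition bseq s p j : C := if blk j == s then (w s (pos j))%:C%C * p`_(pos j) else 0.

Lemma bpoly_bseq s t p : (size p <= bsz s)%N -> bpoly t (bseq s p) = if t == s then p else 0.
Proof.
move=> sp; apply/polyP => k; rewrite coef_poly; case: ltnP => kt; last first.
  by case: eqP => [ts|_]; rewrite ?coef0 // nth_default // (leq_trans sp) // -ts.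
rewrite /bseq blk_boff // pos_boff //; case: eqP => [->|_]; last by rewrite mul0r coef0.
by rewrite mulrC mulKf ?wc_neq0.
Qed.

Fact bseq_l2 s p : bseq s p \in l2pred.
Proof.
apply/l2predP; exists (bnorm s p) => n.
apply: le_trans (ell_widen _ (leq_trans (leq_boff bsz_gt0 n) (boff_mono bsz (leq_addr s.+1 n)))) _.
rewrite -(@ler_pXn2r _ 2) ?nnegrE // !ell_sqr.
rewrite (sum_boff bsz _ (fun j => modc (bseq s p j) ^+ 2)).
have sm : (s < n + s.+1)%N by rewrite addnS ltnS leq_addl.
rewrite (bigD1 (Ordinal sm)) //= [X in _ + X]big1 ?addr0; last first.
  move=> t ts; rewrite big1 // => i _; rewrite /bseq blk_boff // ifF ?modc0 ?expr0n //.
  by apply/negP => /eqP ts'; case/eqP: ts; apply: val_inj.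
by apply: ler_sum => i _; rewrite /bseq blk_boff // eqxx pos_boff.
Qed.
Definition bvec s p := L2 (bseq_l2 s p).

Lemma bpoly_bvec s t p : (size p <= bsz s)%N -> bpoly t (bvec s p) = if t == s then p else 0.
Proof. exact: bpoly_bseq. Qed.

Lemma bvecD s p q : bvec s (p + q) = bvec s p + bvec s q.
Proof.
apply: l2P => j; rewrite l2D /= /bseq; case: ifP; rewrite ?addr0 // => _.
by rewrite coefD mulrDr.
Qed.

Lemma bvecZ s c p : bvec s (c *: p) = c *: bvec s p.
Proof.
apply: l2P => j; rewrite l2Z /= /bseq; case: ifP; rewrite ?mulr0 // => _.
by rewrite coefZ mulrCA.
Qed.

Lemma bvec_sum s (I : Type) (r : seq I) (c : I -> C) (p : I -> {poly C}) :
  bvec s (\sum_(i <- r) c i *: p i) = \sum_(i <- r) c i *: bvec s (p i).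
Proof.
elim: r => [|i r IH]; last by rewrite !big_cons bvecD bvecZ IH.
by rewrite !big_nil; apply: l2P => j; rewrite /= /bseq coef0 mulr0; case: ifP.
Qed.

Lemma l2norm_bvec s p : l2norm (bvec s p) = bnorm s p.
Proof.
apply/eqP; rewrite eq_le; apply/andP; split.
  apply: l2norm_le_blocks => // m; case: (ltnP s m) => sm.
    rewrite (bigD1 (Ordinal sm)) //= big1 ?addr0; last first.
      move=> t ts; rewrite bnormE /ell big1 ?sqrtr0 ?expr0n // => k _.
      rewrite /= /bseq blk_boff // ifF ?modc0 ?expr0n //.
      by apply/negP => /eqP ts'; case/eqP: ts; apply: val_inj.
    rewrite ler_pXn2r ?nnegrE // bnormE; apply: ell_le => k ks.
    by rewrite /= /bseq blk_boff // eqxx pos_boff.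
  rewrite big1 ?sqr_ge0 // => t _; rewrite bnormE /ell big1 ?sqrtr0 ?expr0n // => k _.
  rewrite /= /bseq blk_boff // ifF ?modc0 ?expr0n //.
  by apply/negP => /eqP ts'; have := ltn_ord t; rewrite ts' ltnNge sm.
apply: le_trans (ell_le_l2norm (N s.+1) _).
rewrite -(@ler_pXn2r _ 2) ?nnegrE // ell_boff big_ord_recr /= ler_wpDl //.
  by apply: sumr_ge0 => t _; apply: sqr_ge0.
rewrite ler_pXn2r ?nnegrE // bnormE; apply: ell_le => k ks.
by rewrite /= /bseq blk_boff // eqxx pos_boff.
Qed.

Section BlockOperator.
Variables (h : nat -> {poly C}) (M : R).
Hypotheses (M0 : 0 <= M) (sh : forall s, (size (h s) <= (bsz s).+1)%N).
Hypothesis hM : forall s p, (size p <= bsz s)%N ->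
  bnorm s (wrap (bsz s) (h s * p)) <= M * bnorm s p.

Definition bop_seq x j : C :=
  (w (blk j) (pos j))%:C%C * (wrap (bsz (blk j)) (h (blk j) * bpoly (blk j) x))`_(pos j).

Lemma bpoly_bop_seq s x : bpoly s (bop_seq x) = wrap (bsz s) (h s * bpoly s x).
Proof.
have sw := size_wrapM (sh s) (size_bpoly s x).
apply/polyP => k; rewrite coef_poly; case: ltnP => ks; last first.
  by rewrite nth_default // (leq_trans sw).
by rewrite /bop_seq blk_boff // pos_boff // mulrC mulKf ?wc_neq0.
Qed.

Lemma ell_bop_seq n x : ell n (bop_seq x) <= M * l2norm x.
Proof.
apply: le_trans (ell_widen _ (leq_boff bsz_gt0 n)) _.
apply: (@le_trans _ _ (M * ell (N n) x)); last by rewrite ler_wpM2l // ell_le_l2norm.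
rewrite -(@ler_pXn2r _ 2) ?nnegrE ?mulr_ge0 // exprMn !ell_boff mulr_sumr.
apply: ler_sum => s _; rewrite -exprMn.
by rewrite bpoly_bop_seq ler_pXn2r ?nnegrE ?mulr_ge0 // hM // size_bpoly.
Qed.

Fact bop_seq_l2 x : bop_seq x \in l2pred.
Proof. by apply/l2predP; exists (M * l2norm x) => n; apply: ell_bop_seq. Qed.

Definition bop x := L2 (bop_seq_l2 x).

Lemma bop_linear : linear bop.
Proof.
move=> c x y; apply: bpoly_inj => s; rewrite bpolyD bpolyZ !bpoly_bop_seq.
by rewrite bpolyD bpolyZ mulrDr -scalerAr wrapD wrapZ.
Qed.

(** Squared norms add over the blocks, so a bound [M] common to all blocks passes to the orthogonal
    sum. *)
Lemma block_operator : exists B : {linear l2 R -> l2 R},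
  (forall s x, bpoly s (B x) = wrap (bsz s) (h s * bpoly s x)) /\
  forall x, l2norm (B x) <= M * l2norm x.
Proof.
pose B : {linear l2 R -> l2 R} := HB.pack bop (GRing.isLinear.Build _ _ _ _ bop bop_linear).
exists B; split=> [s x|x]; first exact: bpoly_bop_seq.
by apply: l2norm_le => n; apply: ell_bop_seq.
Qed.

End BlockOperator.
End BlockVectors.

(** * Tails of square summable sequences *)

Section Tail.
Context {R : realType}.
Implicit Types (x y : l2 R).

(** The squared norm of a tail is what the head lacks to the full squared norm. Quantifying over [y]
    lets it apply to remainders however they are written. *)
Lemma l2_tail x (e : R) : 0 < e -> exists K, forall y K', (K <= K')%N ->
  (forall j, y j = if (j < K')%N then 0 else x j) -> l2norm y < e.
Proof.
move=> e0; have e2 : 0 < (e / 2) ^+ 2 by rewrite exprn_gt0 // divr_gt0.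
have : (fun n => ell n x ^+ 2) @ \oo --> l2norm x ^+ 2 by apply: cvgM; apply: ell_cvg.
move=> /cvgrPdist_lt/(_ _ e2)[K _ hK]; exists K => y K' KK' hy.
apply: (@le_lt_trans _ _ (e / 2)); last by rewrite ltr_pdivrMr // ltr_pMr // ltr1n.
have ee : 0 <= e / 2 by rewrite divr_ge0 // ltW.
apply: l2norm_le => n; apply: le_trans (ell_widen _ (leq_addl K' n)) _.
rewrite -(@ler_pXn2r _ 2) ?nnegrE //; apply: le_trans (ltW (hK K' KK')).
apply: le_trans (ler_norm _); rewrite lerBrDl.
apply: (@le_trans _ _ (ell (K' + n) x ^+ 2)); last first.
  by rewrite ler_pXn2r ?nnegrE ?l2norm_ge0 // ell_le_l2norm.
rewrite !ell_sqr !big_split_ord /= lerD2l big1 ?add0r.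
  by apply: ler_sum => k _; rewrite hy ifF // ltnNge leq_addr.
by move=> k _; rewrite hy ltn_ord modc0 expr0n.
Qed.

End Tail.

(** * Eigenvectors, summation basis and diagonal operators *)

Section Eigenvectors.
Context {R : realType}.
Local Notation C := R[i].
Variables (bsz : nat -> nat) (w : nat -> nat -> R) (z : nat -> C).
Hypotheses (bsz_gt0 : forall s, (0 < bsz s)%N) (w_gt0 : forall s k, 0 < w s k).
Hypothesis hz : forall s, (bsz s).-primitive_root (z s).
Local Notation N := (boff bsz).
Local Notation blk := (blk bsz_gt0).
Local Notation pos := (pos bsz_gt0).
Local Notation bnorm s := (wn (bsz s) (w s)).
Local Notation bpoly := (bpoly bsz w).
Local Notation bvec := (bvec w bsz_gt0).
Local Notation bidem s := (idem (bsz s) (z s)).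
Implicit Types (x y : l2 R) (p q : {poly C}) (c : C).

Lemma bnorm_le_l2norm s x : bnorm s (bpoly s x) <= l2norm x.
Proof.
apply: le_trans (ell_le_l2norm (N s.+1) x).
rewrite -(@ler_pXn2r _ 2) ?nnegrE // (ell_boff bsz w_gt0) big_ord_recr /= lerDr.
by apply: sumr_ge0 => t _; apply: sqr_ge0.
Qed.

Lemma bnorm_eq0 s p : (size p <= bsz s)%N -> bnorm s p = 0 -> p = 0.
Proof.
move=> sp h; apply/polyP => k; rewrite coef0; case: (ltnP k (bsz s)) => ks.
  by apply/eqP; have /eqP := ell_eq0 h ks; rewrite mulf_eq0 (negPf (wc_neq0 w_gt0 s k)).
by rewrite nth_default // (leq_trans sp).
Qed.

Definition evec j : l2 R := bvec (blk j) (bidem (blk j) (pos j)).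

Lemma evec_boff s i : (i < bsz s)%N -> evec (N s + i) = bvec s (bidem s i).
Proof. by move=> hi; rewrite /evec blk_boff // pos_boff. Qed.

(** Interpolation of the values [a] at the roots of unity. It is both the block [s] of a series with
    coefficients [a] and the multiplier of a diagonal operator with eigenvalues [a]. *)
Definition coef_poly_of (a : nat -> C) s : {poly C} :=
  \sum_(i < bsz s) a (N s + i)%N *: bidem s i.

Lemma size_coef_poly_of a s : (size (coef_poly_of a s) <= bsz s)%N.
Proof.
apply: leq_trans (size_sum _ _ _) _; apply/bigmax_leqP => i _.
by apply: leq_trans (size_scale_leq _ _) (size_idem _ _ _).
Qed.

Lemma coef_poly_of_horner a s i : (i < bsz s)%N ->
  (coef_poly_of a s).[z s ^+ i] = a (N s + i)%N.
Proof.
move=> hi; rewrite horner_sum (bigD1 (Ordinal hi)) //= hornerZ.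
rewrite (idem_horner (bsz_gt0 s) (hz s)) // eqxx mulr1 big1 ?addr0 // => k ki.
rewrite hornerZ (idem_horner (bsz_gt0 s) (hz s)) //.
by rewrite (_ : (k == i :> nat) = false) ?mulr0 //; apply: negbTE.
Qed.

Lemma sum_evec_block (a : nat -> C) m :
  \sum_(j < N m) a j *: evec j = \sum_(s < m) bvec s (coef_poly_of a s).
Proof.
rewrite (sum_boff bsz m (fun j => a j *: evec j)); apply: eq_bigr => s _.
by rewrite bvec_sum; apply: eq_bigr => i _; rewrite evec_boff.
Qed.

Lemma sum_bvec_coord m (P : nat -> {poly C}) j :
  (\sum_(s < m) bvec s (P s)) j =
  if (j < N m)%N then (w (blk j) (pos j))%:C%C * (P (blk j))`_(pos j) else 0.
Proof.
rewrite l2_sum /= /bseq; case: ltnP => jm.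
  have bm : (blk j < m)%N.
    rewrite ltnNge; apply/negP => /(boff_mono bsz) h.
    by have := leq_ltn_trans (leq_trans h (boff_blk_le bsz_gt0 j)) jm; rewrite ltnn.
  rewrite (bigD1 (Ordinal bm)) //= eqxx big1 ?addr0 // => s sj.
  by rewrite ifF //; apply/negP => /eqP js; case/eqP: sj; apply: val_inj.
rewrite big1 // => s _; rewrite ifF //; apply/negP => /eqP js.
by have := leq_blk bsz_gt0 jm; rewrite js leqNgt ltn_ord.
Qed.

Lemma bpoly_coef x j : (w (blk j) (pos j))%:C%C * (bpoly (blk j) x)`_(pos j) = x j.
Proof. by rewrite (coef_bpoly w_gt0) ?pos_lt // boff_pos. Qed.

Lemma sum_bvec_bpoly_coord m x j :
  (\sum_(s < m) bvec s (bpoly s x)) j = if (j < N m)%N then x j else 0.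
Proof. by rewrite (sum_bvec_coord m (fun s => bpoly s x)) bpoly_coef. Qed.

Lemma sum_bvec_bpoly_near x (e : R) : 0 < e -> exists K, forall m, (K <= m)%N ->
  l2norm (x - \sum_(s < m) bvec s (bpoly s x)) < e.
Proof.
move=> e0; have [K hK] := l2_tail x e0; exists K => m Km.
apply: (hK _ (N m)); first exact: leq_trans Km (leq_boff bsz_gt0 m).
by move=> j; rewrite l2B sum_bvec_bpoly_coord; case: ifP; rewrite ?subrr ?subr0.
Qed.

(** The [n]-th partial sum stops at the last block boundary not exceeding [n], so that incomplete
    blocks never appear. *)
Definition block_matrix n j : C := if (j < N (blk n))%N then 1 else 0.

Lemma sum_block_matrix (a : nat -> C) n :
  \sum_(j < n.+1) (block_matrix n j * a j) *: evec j =
  \sum_(s < blk n) bvec s (coef_poly_of a s).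
Proof.
rewrite -sum_evec_block (big_ord_widen n.+1 (fun j => a j *: evec j)); last first.
  exact: leqW (boff_blk_le bsz_gt0 n).
rewrite [RHS]big_mkcond; apply: eq_bigr => j _.
by rewrite /block_matrix; case: ifP; rewrite ?mul1r // mul0r scale0r.
Qed.

Lemma partial_sums_cvgP (a : nat -> C) x :
  (fun n => \sum_(j < n.+1) (block_matrix n j * a j) *: evec j) @ \oo --> x <->
  forall e : R, 0 < e -> exists K, forall n, (K <= n)%N ->
    l2norm (x - \sum_(s < blk n) bvec s (coef_poly_of a s)) < e.
Proof.
have -> : (fun n => \sum_(j < n.+1) (block_matrix n j * a j) *: evec j) =
    (fun n => \sum_(s < blk n) bvec s (coef_poly_of a s)).
  by apply/funext => n; rewrite sum_block_matrix.
split=> [/l2_cvgP h e e0|h]; first by have [K _ hK] := h e e0; exists K.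
by apply/l2_cvgP => e e0; have [K hK] := h e e0; exists K.
Qed.

Lemma evec_summation_basis : summation_basis (H := l2hilbert) evec block_matrix.
Proof.
split=> [n j nj|x].
  rewrite /block_matrix ifF //; apply/negbTE; rewrite -leqNgt.
  exact: leq_trans (boff_blk_le bsz_gt0 n) (ltnW nj).
(* Values at the roots of unity are the coordinates of a block polynomial in the basis of
   idempotents. *)
pose a j := (bpoly (blk j) x).[z (blk j) ^+ pos j].
exists a; split=> [|b hb].
  apply: (iffRL (partial_sums_cvgP a x)) => e e0; have [K hK] := sum_bvec_bpoly_near x e0.
  exists (N K) => n Kn.
  rewrite (eq_bigr (fun s : 'I_(blk n) => bvec s (bpoly s x))).
    by apply: hK; apply: leq_blk.
  move=> s _.
  congr (bvec s _); rewrite [RHS](sum_idem (bsz_gt0 s) (hz s) (size_bpoly _ _ _ _)).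
  by apply: eq_bigr => i _; rewrite /a blk_boff ?pos_boff.
(* Uniqueness: a coordinate of block [s] no longer changes in the partial sums once the block is
   complete, so it equals that of the limit. *)
have hP s : coef_poly_of b s = bpoly s x.
  apply/polyP => k; case: (ltnP k (bsz s)) => ks; last first.
    by rewrite !nth_default // (leq_trans _ ks) ?size_bpoly ?size_coef_poly_of.
  apply: (mulfI (wc_neq0 w_gt0 s k)); rewrite (coef_bpoly w_gt0) //.
  apply/eqP; rewrite -subr_eq0 -modc_eq0 eq_le modc_ge0 andbT.
  apply/ler_addgt0Pr => e e0; rewrite add0r.
  have [K hK] := iffLR (partial_sums_cvgP b x) hb e e0; pose n := maxn K (N s.+1).
  have := hK n (leq_maxl _ _).
  set S := \sum_(t < _) _ => hS; apply: le_trans (ltW hS).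
  rewrite -opprB modcN; have -> : (w s k)%:C%C * (coef_poly_of b s)`_k = S (N s + k)%N.
    rewrite /S sum_bvec_coord blk_boff // pos_boff // ifT //.
    have h : (s.+1 <= blk n)%N by apply: leq_blk; apply: leq_maxr.
    by apply: leq_trans (boff_mono bsz h); rewrite boffS ltn_add2l.
  exact: (modc_le_l2norm (x - S) (N s + k)).
by apply/funext => j; rewrite /a -hP coef_poly_of_horner ?pos_lt // boff_pos.
Qed.

(** Coordinates are continuous, so those that vanish on finite combinations vanish on the
    closure. *)
Lemma closed_span_block x s :
  closed_span (H := l2hilbert) evec [set j | (N s <= j < N s.+1)%N] x ->
  forall j, blk j != s -> x j = 0.
Proof.
move=> hx j js; apply/eqP; rewrite -modc_eq0 eq_le modc_ge0 andbT.
apply/ler_addgt0Pr => e e0; rewrite add0r.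
have hB : nbhs (x : l2 R) [set y : l2 R | l2norm (x - y) < e].
  have /l2_cvgP/(_ e e0) : (id : l2 R -> l2 R) @ (nbhs (x : l2 R)) --> x by exact: cvg_id.
  exact.
have [y [[n [a [a0 ->]]] hy]] := hx _ hB.
have -> : x j = (x - \sum_(k < n) a k *: evec k) j.
  rewrite l2B l2_sum big1 ?subr0 // => k _; rewrite l2Z /= /bseq.
  case: ifP => [/eqP jk|_]; last by rewrite mulr0.
  rewrite a0 ?mul0r //= => hk; move/eqP: js; apply; rewrite jk.
  exact: blk_eq.
exact: le_trans (modc_le_l2norm _ _) (ltW hy).
Qed.

Lemma evec_block_orthogonal : block_orthogonal (H := l2hilbert) evec.
Proof.
exists N; split=> [|s|s t st x y hx hy]; first by rewrite /boff big_ord0.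
  by rewrite boffS -addn1 leq_add2l.
apply: l2inner_disjoint => k; case: (eqVneq (blk k) s) => ks.
  by right; apply: (closed_span_block hy); rewrite ks.
by left; apply: (closed_span_block hx).
Qed.

Lemma bvec_span s p (I : set nat) : (size p <= bsz s)%N ->
  (forall i, (i < bsz s)%N -> ~ I (N s + i)%N -> p.[z s ^+ i] = 0) ->
  closed_span (H := l2hilbert) evec I (bvec s p).
Proof.
move=> sp hp; apply: subset_closure.
pose a j := if blk j == s then p.[z s ^+ pos j] else 0.
exists (N s.+1), a; split=> [j Ij|].
  rewrite /a; case: eqP => // js; apply: hp; first by rewrite -js pos_lt.
  by rewrite -js boff_pos.
rewrite sum_evec_block big_ord_recr /= big1 ?add0r => [|t _].
  congr (bvec s _); rewrite [LHS](sum_idem (bsz_gt0 s) (hz s) sp).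
  by apply: eq_bigr => i _; rewrite /a blk_boff // eqxx pos_boff.
rewrite /coef_poly_of big1 => [|i _].
  by apply: l2P => j; rewrite /= /bseq coef0 mulr0; case: ifP.
rewrite /a blk_boff // ifF ?scale0r //; apply/negP => /eqP ts.
by have := ltn_ord t; rewrite ts ltnn.
Qed.

Section DiagonalOperator.
Variables (T : {linear l2 R -> l2 R}) (lam : nat -> C).
Hypotheses (hT : forall x, l2norm (T x) <= l2norm x).
Hypothesis eT : forall j, T (evec j) = lam j *: evec j.
Local Notation f := (coef_poly_of lam).

(** Both sides expand in idempotents, and multiplication by [f s] multiplies the values at the roots
    of unity by the eigenvalues. *)
Lemma diag_bvec s p : (size p <= bsz s)%N -> T (bvec s p) = bvec s (wrap (bsz s) (f s * p)).
Proof.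
move=> sp; rewrite {1}(sum_idem (bsz_gt0 s) (hz s) sp) bvec_sum linear_sum.
have sw : (size (wrap (bsz s) (f s * p)) <= bsz s)%N.
  by apply: size_wrapM => //; apply/leqW/size_coef_poly_of.
rewrite [in RHS](sum_idem (bsz_gt0 s) (hz s) sw) bvec_sum.
apply: eq_bigr => i _; rewrite linearZ /= -evec_boff // eT scalerA.
rewrite wrap_horner ?(prim_exp_order (hz s)) // hornerM coef_poly_of_horner //.
by rewrite mulrC.
Qed.

(** Extends [diag_bvec] by density of finite sums of blocks; contractivity controls the
    remainder. *)
Lemma diag_bpoly s x : bpoly s (T x) = wrap (bsz s) (f s * bpoly s x).
Proof.
have sw : (size (wrap (bsz s) (f s * bpoly s x)) <= bsz s)%N.
  by apply: size_wrapM (size_bpoly _ _ _ _); apply/leqW/size_coef_poly_of.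
apply/eqP; rewrite -subr_eq0; apply/eqP; apply: (@bnorm_eq0 s).
  by apply: leq_trans (size_polyD _ _) _; rewrite size_polyN geq_max sw size_bpoly.
apply/eqP; rewrite eq_le wn_ge0 andbT; apply/ler_addgt0Pr => e e0; rewrite add0r.
have [K hK] := sum_bvec_bpoly_near x e0; pose m := maxn K s.+1.
set y := \sum_(t < m) bvec t (bpoly t x).
have hy : bpoly s (T y) = wrap (bsz s) (f s * bpoly s x).
  have -> : T y = \sum_(t < m) bvec t (wrap (bsz t) (f t * bpoly t x)).
    by rewrite /y linear_sum; apply: eq_bigr => t _; rewrite /= diag_bvec ?size_bpoly.
  apply/polyP => k; case: (ltnP k (bsz s)) => ks; last first.
    by rewrite !nth_default // (leq_trans _ ks) ?size_bpoly.
  apply: (mulfI (wc_neq0 w_gt0 s k)); rewrite (coef_bpoly w_gt0) //.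
  rewrite (sum_bvec_coord m (fun t => wrap (bsz t) (f t * bpoly t x))) blk_boff // pos_boff //.
  rewrite ifT //; apply: leq_trans (boff_mono bsz (leq_maxr K s.+1)).
  by rewrite boffS ltn_add2l.
rewrite -hy -bpolyB -linearB /=; apply: le_trans (bnorm_le_l2norm _ _) _.
by apply: le_trans (hT _) _; apply/ltW/hK/leq_maxl.
Qed.

Lemma diag_contraction s p : (size p <= bsz s)%N ->
  bnorm s (wrap (bsz s) (f s * p)) <= bnorm s p.
Proof.
move=> sp; rewrite -!(l2norm_bvec bsz_gt0 w_gt0) -diag_bvec //.
Qed.

(** The inverse multiplies by the interpolation of the inverse eigenvalues; [hM] applied to its
    values bounds it on each block. *)
Lemma diag_invertible (M : R) : 0 <= M -> (forall j, lam j != 0) ->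
  (forall s p, (size p <= bsz s)%N -> bnorm s p <= M * bnorm s (wrap (bsz s) (f s * p))) ->
  exists S : {linear l2 R -> l2 R},
    [/\ forall x, l2norm (S x) <= M * l2norm x, cancel T S & cancel S T].
Proof.
move=> M0 lam0 hM; pose g := coef_poly_of (fun j => (lam j)^-1).
have sg s : (size (g s) <= (bsz s).+1)%N by apply/leqW/size_coef_poly_of.
have sf s : (size (f s) <= (bsz s).+1)%N by apply/leqW/size_coef_poly_of.
have fg (u v : nat -> C) s p : (forall j, u j * v j = 1) -> (size p <= bsz s)%N ->
    wrap (bsz s) (coef_poly_of u s * wrap (bsz s) (coef_poly_of v s * p)) = p.
  move=> uv sp; apply: (horner_inj (bsz_gt0 s) (hz s)) => // [|j js].
    by do 2!(apply: size_wrapM; first exact/leqW/size_coef_poly_of).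
  rewrite !(wrap_horner, hornerM) ?(prim_exp_order (hz s)) // !coef_poly_of_horner //.
  by rewrite mulrA uv mul1r.
have hS s p : (size p <= bsz s)%N -> bnorm s (wrap (bsz s) (g s * p)) <= M * bnorm s p.
  move=> sp; have := hM s _ (size_wrapM (sg s) sp).
  by rewrite fg // => j; rewrite divff.
have [S [SE SM]] := block_operator bsz_gt0 w_gt0 M0 sg hS.
exists S; split=> // x; apply: (bpoly_inj bsz_gt0 w_gt0) => s.
  by rewrite SE diag_bpoly fg ?size_bpoly // => j; rewrite mulVf.
by rewrite diag_bpoly SE fg ?size_bpoly // => j; rewrite divff.
Qed.

End DiagonalOperator.
End Eigenvectors.

(** * Operator norm, boundedness and left invertibility *)

Section OperatorNorm.
Context {R : realType}.
Local Notation C := R[i].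
Implicit Types (T : {linear l2 R -> l2 R}) (x : l2 R).

Lemma bounded_l2 T (M : R) : 0 <= M -> (forall x, l2norm (T x) <= M * l2norm x) ->
  bounded_operator (H := l2hilbert) T.
Proof.
move=> M0 hT; apply/linear_boundedP.
exists M%:C%C; split=> [|r Mr x]; first by apply/complex_realP; exists M.
change ((l2norm (T x))%:C%C <= r * (l2norm x)%:C%C).
apply: (@le_trans _ _ (M%:C%C * (l2norm x)%:C%C)); first by rewrite -rmorphM lecR.
by rewrite ler_wpM2r ?(ltW Mr) ?ler0c ?l2norm_ge0.
Qed.

Lemma opnorm_le1P T : (opnorm (H := l2hilbert) T <= 1)%E <-> forall x, l2norm (T x) <= l2norm x.
Proof.
split=> [h x|h]; last first.
  apply: ge_ereal_sup => _ [x /= x1 <-]; rewrite lee_fin; exact: le_trans (h x) x1.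
have [x0|x0] := eqVneq (l2norm x) 0.
  by rewrite (l2norm_eq0 x0) linear0.
have x1 : 0 < l2norm x by rewrite lt_def x0 l2norm_ge0.
pose c := (l2norm x)^-1.
have c0 : 0 < c by rewrite invr_gt0.
have : ((l2norm (T (c%:C%C *: x)))%:E <= 1)%E.
  apply: le_trans h; apply: ereal_sup_ubound; exists (c%:C%C *: x) => //=.
  change (l2norm (c%:C%C *: x) <= 1); rewrite l2normZ modc_pos ?(ltW c0) // mulVf //.
by rewrite lee_fin linearZ l2normZ modc_pos ?(ltW c0) // ler_pdivrMl // mulr1.
Qed.

Lemma opnorm_ge T x : x != 0 ->
  ((l2norm (T x) / l2norm x)%:E <= opnorm (H := l2hilbert) T)%E.
Proof.
move=> x0; have nx0 : l2norm x != 0 by apply: contra_neq x0; apply: l2norm_eq0.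
have c0 : 0 <= (l2norm x)^-1 by rewrite invr_ge0 l2norm_ge0.
apply: ereal_sup_ubound; exists ((l2norm x)^-1%:C%C *: x) => /=.
  by change (l2norm ((l2norm x)^-1%:C%C *: x) <= 1); rewrite l2normZ modc_pos // mulVf.
congr (_%:E); change (l2norm (T ((l2norm x)^-1%:C%C *: x)) = l2norm (T x) / l2norm x).
by rewrite linearZ l2normZ modc_pos // mulrC.
Qed.

Lemma left_invertible_lower_bound T (K : set (l2 R)) :
  (forall (c : C) x, K x -> K (c *: x)) ->
  left_invertible_on (H := l2hilbert) T K ->
  exists2 kap : R, 0 < kap & forall x, K x -> kap * l2norm x <= l2norm (T x).
Proof.
move=> KZ; rewrite /left_invertible_on; set m := ereal_inf _ => hm.
have [kap kap0 hk] : exists2 kap : R, 0 < kap & (kap%:E <= m)%E.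
  case: m hm => [r||//] hr; first by exists r.
  (* An infinite infimum allows any constant. *)
  by exists 1 => //; rewrite leey.
exists kap => // x Kx; have [x0|x0] := eqVneq (l2norm x) 0.
  by rewrite x0 mulr0 l2norm_ge0.
have x1 : 0 < l2norm x by rewrite lt_def x0 l2norm_ge0.
have c0 : 0 <= (l2norm x)^-1 by rewrite invr_ge0 ltW.
have : (kap%:E <= (l2norm (T ((l2norm x)^-1%:C%C *: x)))%:E)%E.
  apply: le_trans hk _; apply: ereal_inf_lbound.
  exists ((l2norm x)^-1%:C%C *: x) => //=; split; first exact: KZ.
  by change (l2norm ((l2norm x)^-1%:C%C *: x) = 1); rewrite l2normZ modc_pos // mulVf.
by rewrite lee_fin linearZ l2normZ modc_pos // ler_pdivlMl // mulrC.
Qed.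

Lemma closed_spanZ (e : nat -> l2 R) (I : set nat) (c : C) x :
  closed_span (H := l2hilbert) e I x -> closed_span (H := l2hilbert) e I (c *: x).
Proof.
move=> hx B hB.
have [d d0 hd] : exists2 d : R, 0 < d & forall y, l2norm (c *: x - y) < d -> B y.
  have /nbhs_ballP[_ /gt0_complexP[d d0 ->] hd] := hB.
  by exists d => // y hy; apply: hd; rewrite -ball_normE /= l2_normE ltcR.
have m0 : 0 < modc c + 1 by rewrite ltr_wpDl.
have hN : nbhs (x : l2 R) [set y : l2 R | l2norm (x - y) < d / (modc c + 1)].
  have /l2_cvgP/(_ _ (divr_gt0 d0 m0)) : (id : l2 R -> l2 R) @ (nbhs (x : l2 R)) --> x.
    exact: cvg_id.
  exact.
have [y [[n [a [a0 yE]]] hy]] := hx _ hN.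
exists (c *: y); split.
  exists n, (fun j => c * a j); split=> [j Ij|]; first by rewrite a0 // mulr0.
  by rewrite yE scaler_sumr; apply: eq_bigr => j _; rewrite scalerA.
apply: hd; rewrite -scalerBr l2normZ.
apply: (@le_lt_trans _ _ ((modc c) * (d / (modc c + 1)))); first by rewrite ler_wpM2l // ltW.
by rewrite mulrA ltr_pdivrMr // mulrC ltr_pM2l // ltrDl.
Qed.

End OperatorNorm.

(** * Contractivity of the shift *)

Section Shift.
Context {R : realType}.
Local Notation C := R[i].
Implicit Types (p : {poly C}) (w : nat -> R).

(** Each coefficient moves up one degree, where [d] compensates the growth of the weight, except the
    last one, which wraps to degree 0. *)
Lemma wn_shift_le n w (d : R) p : (0 < n)%N -> 0 <= d -> (forall k, 0 <= w k) ->
  (forall k, (k.+1 < n)%N -> d * w k.+1 <= w k) -> d * w 0%N <= w n.-1 ->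
  (size p <= n)%N -> wn n w (wrap n ((d%:C%C *: 'X) * p)) <= wn n w p.
Proof.
move=> n0 d0 w0 hw hw0 sp; rewrite -scalerAl wrapZ wnZ modc_pos //.
case: n n0 hw hw0 sp => // m _ hw hw0 sp.
have E : wn m.+1 w (wrap m.+1 ('X * p)) ^+ 2 =
    \sum_(k < m) modc ((w k.+1)%:C%C * p`_k) ^+ 2 + modc ((w 0%N)%:C%C * p`_m) ^+ 2.
  rewrite ell_sqr big_ord_recl addrC; congr (_ + _).
    apply: eq_bigr => k _; rewrite /wrap coefD coef_take_poly coef_drop_poly !coefXM /=.
    rewrite /bump /= add1n ltnS ltn_ord add0n [p`_(_ + m.+1)]nth_default ?addr0 //.
    by rewrite (leq_trans sp) // leq_addl.
  by rewrite /wrap coefD coef_take_poly coef_drop_poly !coefXM /= add0r.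
rewrite -(@ler_pXn2r _ 2) ?nnegrE ?mulr_ge0 // exprMn E ell_sqr big_ord_recr /=.
rewrite mulrDr mulr_sumr; apply: lerD.
  apply: ler_sum => k _; rewrite -exprMn ler_pXn2r ?nnegrE ?mulr_ge0 //.
  by rewrite !modcM !modc_pos // mulrA ler_wpM2r // hw // ltnS.
rewrite -exprMn ler_pXn2r ?nnegrE ?mulr_ge0 //.
by rewrite !modcM !modc_pos // mulrA ler_wpM2r.
Qed.

End Shift.

(** Pigeonhole: the classes cover, so their cardinals add up to at least [n]. *)
Lemma large_color (r n : nat) (P : 'I_r -> 'I_n -> bool) :
  (0 < n)%N -> (forall i, exists c, P c i) ->
  exists c, (n <= r * #|P c|)%N /\ (0 < #|P c|)%N.
Proof.
move=> n0 hP.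
have hs : (n <= \sum_(c < r) #|P c|)%N.
  rewrite -[X in (X <= _)%N]card_ord -sum1_card.
  rewrite (eq_bigr (fun c => \sum_(i < n) (P c i : nat))%N); last first.
    by move=> c _; rewrite -sum1_card big_mkcond; apply: eq_bigr => i _; rewrite unfold_in; case: (P c i).
  rewrite exchange_big; apply: leq_sum => i _ /=.
  by have [c hc] := hP i; rewrite (bigD1 c) //= hc.
have [c hc] : exists c, (n <= r * #|P c|)%N.
  case: (pselect (exists c, (n <= r * #|P c|)%N)) => // hn; exfalso.
  have r0 : (0 < r)%N.
    by have [c _] := hP (Ordinal n0); case: (r) c => [[]|].
  have : (\sum_(c < r) (r * #|P c| + 1) <= \sum_(c < r) n)%N.
    apply: leq_sum => c _; rewrite addn1 ltnNge; apply/negP => h; apply: hn.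
    by exists c.
  rewrite big_split /= -big_distrr /= !sum_nat_const card_ord muln1.
  have := hs; rewrite -(leq_pmul2l r0) => h1 h2.
  have := leq_trans h2 h1; rewrite -[X in (_ <= X)%N]addn0 leq_add2l leqNgt r0 //.
exists c; split=> //; rewrite lt0n; apply/eqP => h.
by move: hc; rewrite h muln0 leqNgt n0.
Qed.

(** * Choice of the block lengths and weights *)

Section WeightChoice.
Context {R : realType}.
Local Notation C := R[i].
Variables (dl : R).
Hypothesis hdl : 0 < dl < 1.

(* Block lengths [b^4] and weights [(1 + gam k) r^k] with [gam < 1 / dl - 1] and
   [r = 1 / (dl (1 + gam))]. As [b] grows, [r^n] is unbounded, which defeats every
   partition, while [(r - 1) sqrt n] tends to [0], which keeps the radii [1] and [r]
   indistinguishable for the polynomials of weighted norm at most [1]. *)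
Definition blen s := (s.+1 ^ 4)%N.
Definition dgap := dl^-1 - 1.
(** Distance of [gam] from the critical value [dgap], at which the radius would be 1. For [n = b^4],
    its order [b^-3] makes [(r - 1) n] diverge and [(r - 1) sqrt n] tend to 0. *)
Definition bgap s := dgap / (2 * s.+1%:R ^+ 3).
Definition bgam s := dgap - bgap s.
Definition brad s := dl^-1 / (1 + bgam s).
Definition bwt s := bweight (bgam s) (brad s).

Lemma blen_gt0 s : (0 < blen s)%N.
Proof. by rewrite expn_gt0. Qed.

Lemma blenR s : (blen s)%:R = s.+1%:R ^+ 4 :> R.
Proof. by rewrite natrX. Qed.

Lemma sqrt_blen s : Num.sqrt (blen s)%:R = s.+1%:R ^+ 2 :> R.
Proof. by rewrite blenR (exprM _ 2 2) sqrtr_sqr ger0_norm // sqr_ge0. Qed.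

Lemma dgap_gt0 : 0 < dgap.
Proof. by case/andP: hdl => d0 d1; rewrite subr_gt0 invf_gt1. Qed.

Lemma natS_ge1 s : 1 <= s.+1%:R :> R.
Proof. by rewrite ler1n. Qed.

Lemma bgap_gt0 s : 0 < bgap s.
Proof. by rewrite divr_gt0 ?dgap_gt0 // mulr_gt0 // exprn_gt0. Qed.

Lemma bgap_le s : bgap s * s.+1%:R <= dgap / 2.
Proof.
rewrite /bgap mulrAC ler_pdivrMr ?mulr_gt0 ?exprn_gt0 //.
rewrite mulrA divfK // ler_pM2l ?dgap_gt0 // exprS ler_peMr //.
by rewrite exprn_ege1 ?natS_ge1.
Qed.

Lemma bgam_ge s : dgap / 2 <= bgam s.
Proof.
have := bgap_le s; have := ler_wpM2l (ltW (bgap_gt0 s)) (natS_ge1 s).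
rewrite /bgam mulr1; lra.
Qed.

Lemma bgam_gt0 s : 0 < bgam s.
Proof. by apply: lt_le_trans (bgam_ge s); rewrite divr_gt0 // dgap_gt0. Qed.

Lemma bgam1_gt0 s : 0 < 1 + bgam s.
Proof. by rewrite addr_gt0 // bgam_gt0. Qed.

Lemma brad_eq s : dl * (1 + bgam s) * brad s = 1.
Proof.
case/andP: hdl => d0 _; have h := bgam1_gt0 s; rewrite /brad.
by field; rewrite !gt_eqF.
Qed.

Lemma brad_sub1 s : brad s - 1 = bgap s / (1 + bgam s).
Proof.
have h : 1 + bgam s != 0 by rewrite gt_eqF ?bgam1_gt0.
apply: (mulIf h); rewrite mulrBl !divfK // mul1r /bgam /dgap; ring.
Qed.

Lemma brad_sub1_ge s : dl * bgap s <= brad s - 1.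
Proof.
case/andP: hdl => d0 d1; rewrite brad_sub1 ler_pdivlMr ?bgam1_gt0 //.
have h : dl * (1 + dgap) = 1 by rewrite /dgap addrC subrK divff // gt_eqF.
rewrite mulrAC ler_piMl ?(ltW (bgap_gt0 s)) // -[leRHS]h ler_pM2l // lerD2l /bgam gerBl.
exact/ltW/bgap_gt0.
Qed.

Lemma brad_sub1_le s : brad s - 1 <= bgap s.
Proof.
rewrite brad_sub1 ler_pdivrMr ?bgam1_gt0 // ler_peMr ?(ltW (bgap_gt0 s)) //.
by rewrite lerDl ltW // bgam_gt0.
Qed.

Lemma brad_gt1 s : 1 < brad s.
Proof.
by rewrite -subr_gt0 brad_sub1 divr_gt0 ?bgap_gt0 ?bgam1_gt0.
Qed.

Lemma brad_gt0 s : 0 < brad s.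
Proof. exact: lt_trans ltr01 (brad_gt1 s). Qed.

Lemma bwt_ge1 s k : 1 <= bwt s k.
Proof.
rewrite /bwt /bweight -[1]mulr1 ler_pM // ?exprn_ege1 ?(ltW (brad_gt1 s)) //.
exact: lin_weight_ge1 (bgam_gt0 s) k.
Qed.

Lemma bwt_gt0 s k : 0 < bwt s k.
Proof. exact: lt_le_trans ltr01 (bwt_ge1 s k). Qed.

Lemma bwtS s k : brad s * bwt s k <= bwt s k.+1.
Proof.
rewrite /bwt /bweight mulrCA -exprS ler_wpM2r ?exprn_ge0 ?(ltW (brad_gt0 s)) //.
by rewrite lerD2l ler_wpM2l ?ler_nat // ltW // bgam_gt0.
Qed.

Lemma bwt_mono s k l : (k <= l)%N -> bwt s k <= bwt s l.
Proof.
elim: l => [|l IH]; first by rewrite leqn0 => /eqP ->.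
rewrite leq_eqVlt => /orP[/eqP ->//|]; rewrite ltnS => /IH h; apply: le_trans h _.
by apply: le_trans (bwtS s l); rewrite ler_peMl ?(ltW (bwt_gt0 s l)) ?(ltW (brad_gt1 s)).
Qed.

(** Since [dl * brad dl s] is the inverse of [1 + gam], the claim reduces to
    [a_(k+1) <= (1 + gam) a_k] for the linear weights. *)
Lemma bwtS_le s k : dl * bwt s k.+1 <= bwt s k.
Proof.
have g0 := bgam_gt0 s; have h := bgam1_gt0 s; rewrite /bwt /bweight exprS.
rewrite (_ : dl * _ = dl * brad s * lin_weight (bgam s) k.+1 * brad s ^+ k); last by ring.
rewrite ler_wpM2r ?exprn_ge0 ?(ltW (brad_gt0 s)) //.
have -> : dl * brad s = (1 + bgam s)^-1.
  by apply: (mulIf (lt0r_neq0 h)); rewrite mulVf ?gt_eqF // mulrAC brad_eq.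
rewrite ler_pdivrMl // /lin_weight -natr1.
have := mulr_ge0 (mulr_ge0 (ltW g0) (ltW g0)) (ler0n R k); lra.
Qed.

End WeightChoice.

(** * Bounds over all blocks: invertibility above [dl], and failure of every finite partition for
    the shift *)

Section Threshold.
Context {R : realType}.
Local Notation C := R[i].
Variables (dl : R) (z : nat -> C).
Hypothesis hdl : 0 < dl < 1.
Hypothesis hz : forall s, (blen s).-primitive_root (z s).
Local Notation w := (bwt dl).
Local Notation bnorm s := (wn (blen s) (w s)).
Local Notation bvec := (bvec w blen_gt0).
Local Notation bpoly := (bpoly blen w).
Local Notation evec := (evec w z blen_gt0).
Local Notation N := (boff blen).
Local Notation blk := (blk blen_gt0).
Local Notation pos := (pos blen_gt0).
Implicit Types (f p : {poly C}) (x : l2 R).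

(** Long blocks satisfy the smallness hypotheses of [block_lower_bound]; the finitely many others
    get crude constants, summed so that each is dominated. *)
Lemma uniform_block_lower_bound (dp : R) : dl < dp -> exists2 M : R, 0 <= M &
  forall s f p, (size f <= blen s)%N ->
    (forall j, (j < blen s)%N -> dp <= modc f.[z s ^+ j] <= 1) ->
    (forall q : {poly C}, (size q <= blen s)%N -> bnorm s (wrap (blen s) (f * q)) <= bnorm s q) ->
    (size p <= blen s)%N -> bnorm s p <= M * bnorm s (wrap (blen s) (f * p)).
Proof.
move=> hdp; have dl0 : 0 < dl by case/andP: hdl.
have dp0 : 0 < dp by apply: lt_trans hdp.
have g0 := dgap_gt0 hdl.
pose eta := (dp - dl) / 2; pose K := (2 + 5 / eta) / eta.
have eta0 : 0 < eta by rewrite divr_gt0 // subr_gt0.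
have K0 : 0 < K by rewrite divr_gt0 // addr_gt0 // divr_gt0.
have d20 : 0 < dp ^+ 2 - dl ^+ 2 by rewrite subr_gt0 ltr_pXn2r ?nnegrE ?(ltW dl0) ?(ltW dp0).
(* A sum of four thresholds, one for each of the bounds [c1] to [c4] that yield the smallness
   hypotheses. *)
pose B := eta^-1 + dgap dl / (dp ^+ 2 - dl ^+ 2) + 2 / dgap dl + 4 * K / dgap dl.
have B1 : 0 < eta^-1 by rewrite invr_gt0.
have B2 : 0 < dgap dl / (dp ^+ 2 - dl ^+ 2) by rewrite divr_gt0.
have B3 : 0 < 2 / dgap dl by rewrite divr_gt0.
have B4 : 0 < 4 * K / dgap dl by rewrite divr_gt0 // mulr_gt0.
have B0 : 0 <= B by rewrite !addr_ge0 // ltW.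
pose s0 := Num.bound B; have hs0 : B < s0%:R := archi_boundP B0.
pose small := \sum_(s < s0) w s (blen s) / dp.
have small0 : 0 <= small.
  by apply: sumr_ge0 => s _; rewrite divr_ge0 ?(ltW dp0) // ltW // bwt_gt0.
exists (2 * K + small) => [|s f p sf fz hf sp].
  by rewrite addr_ge0 // mulr_ge0 // ltW.
rewrite mulrDl; case: (ltnP s s0) => ss0.
  apply: (@le_trans _ _ (w s (blen s) / dp * bnorm s (wrap (blen s) (f * p)))).
    apply: (block_crude_bound (blen_gt0 s) (hz s) dp0) => // [k ks|j js].
      by rewrite bwt_ge1 // bwt_mono // ltnW.
    by case/andP: (fz j js).
  apply: ler_wpDl; first by rewrite mulr_ge0 // mulr_ge0 // ltW.
  rewrite ler_wpM2r // /small (bigD1 (Ordinal ss0)) //= lerDl.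
  by apply: sumr_ge0 => t _; rewrite divr_ge0 ?(ltW dp0) // ltW // bwt_gt0.
apply: ler_wpDr; first by rewrite mulr_ge0.
have b1 := natS_ge1 (R := R) s; set b : R := s.+1%:R in b1.
have b0 : 0 < b by apply: lt_le_trans b1.
have hB : B <= b.
  by apply: le_trans (ltW hs0) _; rewrite ler_nat; apply: leqW.
have c1 : b^-1 <= eta.
  by rewrite -[leRHS]invrK lef_pV2 ?posrE //; move: hB; rewrite /B; lra.
have c2 : dgap dl / b <= dp ^+ 2 - dl ^+ 2.
  by rewrite ler_pdivrMr // -ler_pdivrMl // mulrC; move: hB; rewrite /B; lra.
have c3 : 2 / (dgap dl * b) <= 1.
  rewrite ler_pdivrMr ?mulr_gt0 // mul1r -ler_pdivrMl // mulrC.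
  by move: hB; rewrite /B; lra.
have c4 : K * (2 / (dgap dl * b)) <= 1 / 2.
  rewrite mulrA ler_pdivrMr ?mulr_gt0 // mulrA -ler_pdivrMl; last by rewrite mulr_gt0.
  have -> : (1 / 2 * dgap dl)^-1 * (K * 2) = 4 * K / dgap dl by field; rewrite gt_eqF.
  by move: hB; rewrite /B; lra.
have gam0 := bgam_gt0 hdl s.
have nu : (bgam dl s * Num.sqrt (blen s)%:R)^-1 <= 2 / (dgap dl * b).
  rewrite sqrt_blen -/b -[leRHS]invrK invf_div lef_pV2 ?posrE ?mulr_gt0 ?invr_gt0 ?exprn_gt0 //.
  have h := bgam_ge hdl s; rewrite mulrAC; apply: (ler_pM _ _ h).
  - by rewrite divr_ge0 // ltW.
  - exact: ltW.
  - by rewrite exprS ler_peMr // ?expr1 // ltW.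
apply: (block_lower_bound (z := z s) (dl := dl)) => //.
- exact/ltW/brad_gt1.
- exact: brad_eq.
- rewrite sqrt_blen -/b; apply: le_trans c1.
  rewrite mulrAC ler_pdivrMr // ler_pdivlMl //.
  apply: le_trans (bgam_ge hdl s); have -> : dgap dl / 2 = b * (bgap dl s * b ^+ 2).
    by rewrite /bgap -/b; field; rewrite gt_eqF.
  by rewrite ler_pM2l // ler_wpM2r ?exprn_ge0 ?(ltW b0) // brad_sub1_le.
- apply: le_trans c2; apply: (@le_trans _ _ (2 * (brad dl s - 1))).
    have R1 := brad_gt1 hdl s; set r := brad dl s in R1 *.
    have r0 : 0 < r by apply: lt_trans R1.
    rewrite -exprVn; have u1 : r^-1 * r = 1 by rewrite mulVf // gt_eqF.
    have u0 : 0 < r^-1 by rewrite invr_gt0.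
    have u2 : r^-1 < 1 by rewrite invf_lt1.
    by move: u1 u0 u2 (sqr_ge0 (r - 1)); move: r^-1 => u u1 u0 u2 h; nra.
  rewrite ler_pdivlMr // -mulrA mulrC -ler_pdivlMr //.
  apply: le_trans (bgap_le hdl s); rewrite -/b ler_pM2r //.
  exact: brad_sub1_le.
- exact: le_trans nu c3.
- by apply: le_trans c4; rewrite -/eta -/K ler_pM2l.
Qed.

Let w_gt0 := bwt_gt0 hdl.

Lemma evec_neq0 j : evec j != 0.
Proof.
apply/eqP => h; have := l2norm_bvec blen_gt0 w_gt0 (blk j) (idem (blen (blk j)) (z (blk j)) (pos j)).
rewrite -/(evec j) h; have -> : l2norm (0 : l2 R) = 0 by rewrite -[0](scale0r 0) l2normZ modc0 mul0r.
move=> /esym/(bnorm_eq0 w_gt0 (size_idem _ _ _)) h0.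
have := idem_horner (blen_gt0 (blk j)) (hz (blk j)) (pos_lt blen_gt0 j) (pos_lt blen_gt0 j).
by rewrite h0 horner0 eqxx => /esym/eqP; rewrite oner_eq0.
Qed.

Definition is_shift (A : {linear l2 R -> l2 R}) :=
  forall s x, bpoly s (A x) = wrap (blen s) ((dl%:C%C *: 'X) * bpoly s x).

Lemma exists_shift : exists A, is_shift A /\ forall x, l2norm (A x) <= l2norm x.
Proof.
have sX s : (size (dl%:C%C *: 'X : {poly C}) <= (blen s).+1)%N.
  by apply: leq_trans (size_scale_leq _ _) _; rewrite size_polyX ltnS blen_gt0.
have hX s p : (size p <= blen s)%N ->
    bnorm s (wrap (blen s) ((dl%:C%C *: 'X) * p)) <= 1 * bnorm s p.
  move=> sp; have [d0 d1] := andP hdl; rewrite mul1r.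
  apply: wn_shift_le (blen_gt0 s) (ltW d0) _ _ _ sp => [k|k _|].
  - exact/ltW/w_gt0.
  - exact: bwtS_le.
  - apply: (@le_trans _ _ (w s 0%N)); last exact: bwt_mono.
    by rewrite ler_piMl ?(ltW d1) // ltW // w_gt0.
have [A [hA nA]] := block_operator blen_gt0 w_gt0 ler01 sX hX.
by exists A; split=> // x; have := nA x; rewrite mul1r.
Qed.

Variable A : {linear l2 R -> l2 R}.
Hypothesis hA : is_shift A.

Lemma shift_bvec s p : (size p <= blen s)%N ->
  A (bvec s p) = dl%:C%C *: bvec s (wrap (blen s) ('X * p)).
Proof.
move=> sp; apply: (bpoly_inj blen_gt0 w_gt0) => t; rewrite hA bpolyZ.
have sX : (size (wrap (blen s) ('X * p)) <= blen s)%N.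
  by apply: size_wrapM; rewrite ?size_polyX ?ltnS ?blen_gt0.
rewrite !(bpoly_bvec blen_gt0 w_gt0) // -scalerAl wrapZ.
by case: eqP => [->//|_]; rewrite mulr0 /wrap take_poly0r drop_poly0r addr0.
Qed.

Lemma shift_evec j : A (evec j) = (dl%:C%C * z (blk j) ^+ pos j) *: evec j.
Proof.
set s := blk j; set i := pos j; have hi : (i < blen s)%N by exact: pos_lt.
rewrite /evec -/s -/i shift_bvec ?size_idem // -scalerA -[X in _ = _ *: X]bvecZ; congr (_ *: bvec s _).
apply: (horner_inj (blen_gt0 s) (hz s)) => [||k ks].
- by apply: size_wrapM; rewrite ?size_idem ?size_polyX ?ltnS ?blen_gt0.
- by apply: leq_trans (size_scale_leq _ _) (size_idem _ _ _).
rewrite wrap_horner ?(prim_exp_order (hz s)) // hornerM hornerX hornerZ.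
rewrite (idem_horner (blen_gt0 s) (hz s)) //.
by case: eqP => [->//|_]; rewrite !mulr0.
Qed.

Lemma shift_lower_bound s (J : {set 'I_(blen s)}) (kap : R) :
  (0 < #|J|)%N -> 0 < kap ->
  (forall p, vanish_off (z s) J p -> kap * bnorm s p <= l2norm (A (bvec s p))) ->
  kap * brad dl s ^+ #|J|.-1 <= 1.
Proof.
move=> J0 kap0 hk; have [d0 d1] := andP hdl.
have wS k : (k.+1 < blen s)%N -> brad dl s * w s k <= w s k.+1 by move=> _; apply: bwtS.
have w0 k : 0 <= w s k by apply/ltW/w_gt0.
apply: (vanish_off_lower_bound (brad_gt0 hdl s) w0 wS (hz s) (blen_gt0 s) (w_gt0 s _) J0 (ltW kap0)).
move=> p vp; apply: le_trans (hk p vp) _; have [sp _] := vp.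
rewrite shift_bvec // l2normZ (l2norm_bvec blen_gt0 w_gt0) modc_pos ?(ltW d0) //.
by rewrite ler_piMl // ltW.
Qed.

(** If all restrictions had a common lower bound [kap], a class holding a fraction [1 / r] of a
    block would force [kap] times a power of the radius below 1, while these powers are unbounded
    over the blocks. *)
Lemma shift_not_left_invertible (r : nat) (I : 'I_r -> set nat) :
  (forall j, exists c, I c j) ->
  exists c, ~ left_invertible_on (H := l2hilbert) A (closed_span (H := l2hilbert) evec (I c)).
Proof.
move=> cI; apply: contrapT => hn.
have {hn} /choice[kf hkf] : forall c, exists kap : R, 0 < kap /\
    forall x, closed_span (H := l2hilbert) evec (I c) x -> kap * l2norm x <= l2norm (A x).
  move=> c; have hl : left_invertible_on (H := l2hilbert) A (closed_span (H := l2hilbert) evec (I c)).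
    by apply: contrapT => h; apply: hn; exists c.
  have [kap k0 hk] := left_invertible_lower_bound (fun a x => @closed_spanZ R evec (I c) a x) hl.
  by exists kap.
pose kap := \big[Order.min/1]_(c < r) kf c.
have kap0 : 0 < kap by apply: lt_bigmin => // c _; case: (hkf c).
have [d0 d1] := andP hdl; have g0 := dgap_gt0 hdl.
have r0 : (0 < r)%N by have [[m mr] _] := cI 0%N; apply: leq_ltn_trans mr.
have rR : 0 < r%:R :> R by rewrite ltr0n.
have cc : 0 < dl * dgap dl / 2 by rewrite divr_gt0 // mulr_gt0.
have dgd : dl * dgap dl < 1.
  by rewrite /dgap mulrBr mulr1 divff ?gt_eqF // gtrBl.
(* With [b = s.+1], the exponent is at least [b^4 / r - 1] and the radius exceeds 1 by at least a
   multiple of [b^-3], so Bernoulli leaves a growth linear in [b]. *)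
have key s : kap * (1 + (s.+1%:R / r%:R - 1) * (dl * dgap dl / 2)) <= 1.
  pose P (c : 'I_r) (i : 'I_(blen s)) : bool := `[< I c (N s + i)%N >].
  have [|c [hc Jc0]] := @large_color r (blen s) P (blen_gt0 s).
    by move=> i; have [c hc] := cI (N s + i)%N; exists c; apply/asboolP.
  pose J : {set 'I_(blen s)} := finset (P c).
  have cJ : #|J| = #|P c| by rewrite cardsE.
  have [kc0 hkc] := hkf c.
  have := @shift_lower_bound s J (kf c); rewrite cJ => /(_ Jc0 kc0) h.
  have {h} h : kf c * brad dl s ^+ #|P c|.-1 <= 1.
    apply: h => p [sp vp]; rewrite -(l2norm_bvec blen_gt0 w_gt0); apply: hkc.
    apply: (@bvec_span _ _ _ _ blen_gt0 hz) => // i hi nI.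
    by apply: (vp (Ordinal hi)); rewrite inE; apply/asboolP.
  apply: le_trans h; apply: ler_pM => //; first exact: ltW.
  - have := divr_ge0 (ler0n R s.+1) (ltW rR); have := dgd; have := mulr_gt0 d0 g0; nra.
  - exact: bigmin_le.
  - apply: le_trans (ler_exp1D #|P c|.-1 (ltW (brad_gt1 hdl s))); rewrite lerD2l.
    apply: le_trans (ler_wpM2l (ler0n _ _) (brad_sub1_ge hdl s)).
    have b1 := natS_ge1 (R := R) s; set b : R := s.+1%:R in b1 *.
    have b0 : b != 0 by rewrite gt_eqF // (lt_le_trans ltr01).
    have hd : b ^+ 4 / r%:R - 1 <= (#|P c|.-1)%:R.
      rewrite -(prednK Jc0) in hc; rewrite lerBlDr natr1 ler_pdivrMr // mulrC -natrM.
      by rewrite -blenR ler_nat.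
    have b3 : b ^- 3 <= 1 by rewrite invf_le1 ?exprn_ege1 // exprn_gt0 // (lt_le_trans ltr01).
    rewrite (_ : dl * bgap dl s = b ^- 3 * (dl * dgap dl / 2)); last first.
      by rewrite /bgap -/b; field.
    rewrite [leRHS]mulrA ler_wpM2r ?(ltW cc) //.
    apply: (@le_trans _ _ ((b ^+ 4 / r%:R - 1) * b ^- 3)); last first.
      by rewrite ler_wpM2r // invr_ge0 exprn_ge0 // (le_trans ler01).
    rewrite mulrBl mul1r lerB //.
    rewrite (_ : b ^+ 4 / r%:R * b ^- 3 = b / r%:R) //; field.
    by rewrite ?b0 ?gt_eqF.
(* The block size parameter beyond which [key] is violated. *)
pose X := r%:R * (1 + (kap * (dl * dgap dl / 2))^-1).
have X0 : 0 <= X by rewrite mulr_ge0 // addr_ge0 // invr_ge0 ltW // mulr_gt0.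
have hX : X < (Num.bound X).+1%:R by apply: lt_trans (archi_boundP X0) _; rewrite ltr_nat.
move: (Num.bound X) hX => m hX.
have hX' : 1 + (kap * (dl * dgap dl / 2))^-1 < m.+1%:R / r%:R.
  by rewrite ltr_pdivlMr // mulrC.
have kc0 := mulr_gt0 kap0 cc.
have h : 1 < kap * (dl * dgap dl / 2) * (m.+1%:R / r%:R - 1).
  by rewrite -ltr_pdivrMl // mulr1 ltrBrDl.
by have := key m; lra.
Qed.

End Threshold.

(** * Verification of the four properties on the orthogonal sum of blocks *)

Theorem theorem12 (R : realType) (delta : R) (hdelta : 0 < delta < 1) :
  exists (H : hilbertSpace R) (e : nat -> H),
    [/\ (exists v : nat -> nat -> R[i], summation_basis e v),
        block_orthogonal e,
        (exists (A : {linear H -> H}) (lambda : nat -> R[i]),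
          [/\ bounded_operator A,
              (opnorm A <= 1)%E,
              (forall j, A (e j) = lambda j *: e j),
              (forall j,
                [/\ delta <= rnorm (lambda j),
                    rnorm (lambda j) = rnorm (A (e j)) / rnorm (e j) &
                    ((rnorm (A (e j)) / rnorm (e j))%:E <= opnorm A)%E]) &
              forall (r : nat) (I : 'I_r -> set nat),
                classical_sets.partition [set: 'I_r] I [set: nat] ->
                exists s : 'I_r, ~ left_invertible_on A (closed_span e (I s))]) &
        forall (T : {linear H -> H}) (lambda : nat -> R[i]),
          bounded_operator T ->
          (forall j, T (e j) = lambda j *: e j) ->
          (opnorm T <= 1)%E ->
          (ereal_inf [set (rnorm (lambda j))%:E | j in [set: nat]]
             <= opnorm T)%E ->
          (delta%:E < ereal_inf [set (rnorm (lambda j))%:E | j in [set: nat]])%E ->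
          invertible_operator T].
Proof.
have /choice[z hz] : forall s, exists c : R[i], (blen s).-primitive_root c.
  by move=> s; apply: exists_prim_root (blen_gt0 s).
have [d0 d1] := andP hdelta; have w_gt0 := bwt_gt0 hdelta.
pose e := evec (bwt delta) z blen_gt0.
have e0 j : e j != 0 by apply: evec_neq0 hdelta hz j.
have ne0 j : 0 < l2norm (e j).
  by rewrite lt_def l2norm_ge0 andbT; apply: contra_neq (e0 j); apply: l2norm_eq0.
exists l2hilbert, e; split.
- by exists (block_matrix blen_gt0); apply: evec_summation_basis w_gt0 hz.
- exact: evec_block_orthogonal.
- have [A [sA nA]] := exists_shift (R := R) hdelta.
  pose lam j := delta%:C%C * z (blk blen_gt0 j) ^+ pos blen_gt0 j.
  have mlam j : modc (lam j) = delta.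
    by rewrite modcM modc_pos ?(ltW d0) // (modc_prim_exp (blen_gt0 _) (hz _)) mulr1.
  have eA j : A (e j) = lam j *: e j by apply: shift_evec sA j.
  exists A, lam; split.
  + by apply: (@bounded_l2 R A 1) => // x; rewrite mul1r.
  + exact/opnorm_le1P.
  + exact: eA.
  + move=> j; split; first by change (delta <= modc (lam j)); rewrite mlam.
      change (modc (lam j) = l2norm (A (e j)) / l2norm (e j)).
      by rewrite eA l2normZ mulfK // gt_eqF.
    exact: opnorm_ge.
  + move=> r I [cI _ _]; apply: (shift_not_left_invertible hdelta hz sA) => j.
    have [c _ hc] : cover [set: 'I_r] I j by rewrite cI.
    by exists c.
move=> T lam _ eT /opnorm_le1P nT _ hlam.
(* The infimum is finite, lying above [delta] and below [|lam 0|], and serves as [dp]. *)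
have [dp hdp lam_ge] : exists2 dp : R, delta < dp & forall j, dp <= modc (lam j).
  have h j : (ereal_inf [set (rnorm (lam j))%:E | j in [set: nat]] <= (modc (lam j))%:E)%E.
    by apply: ereal_inf_lbound; exists j.
  move: hlam h; case: (ereal_inf _) => [dp||] // hlam h; last by have := h 0%N.
  by exists dp.
have dp0 : 0 < dp by apply: lt_trans hdp.
have lam_le j : modc (lam j) <= 1.
  have := nT (e j); rewrite (eT j) l2normZ -ler_pdivlMr // divff // gt_eqF //.
have [M M0 hM] := uniform_block_lower_bound hdelta hz hdp.
have [||S [SM TS ST]] := diag_invertible w_gt0 hz nT eT M0.
- by move=> j; rewrite -modc_eq0 gt_eqF // (lt_le_trans dp0).
- move=> s p sp; apply: hM => //.
  + exact: size_coef_poly_of.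
  + by move=> j js; rewrite (coef_poly_of_horner blen_gt0 hz) // lam_ge lam_le.
  + by move=> q sq; apply: (diag_contraction w_gt0 hz nT eT sq).
by exists S; split=> //; apply: bounded_l2 M0 SM.
Qed.
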